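(* Every Hermitian matrix $A \in \mathbb{C}^{n\times n}$ is Schur-Horn continuous.
   Context: $\|\cdot\|_{\mathrm F}$ is the Frobenius norm. For $x\in\mathbb{R}^n$, $x^{\uparrow}$ denotes the vector $x$ reordered with entries in non-decreasing order. For $a,\lambda\in\mathbb{R}^n$ we write $\lambda\prec a$ if $\sum_{i=1}^k \lambda_i^{\uparrow}\le \sum_{i=1}^k a_i^{\uparrow}$ for $k=1,\dots,n-1$ and $\sum_{i=1}^n\lambda_i^{\uparrow}=\sum_{i=1}^n a_i^{\uparrow}$. Big-$O$ convention: $\varepsilon>0$ is the asymptotic variable tending to zero; perturbed quantities are families indexed by sufficiently small $\varepsilon>0$; all other data (matrix dimension, the matrix $A$) are constants. Definition (Schur-Horn continuity, Hermitian case). Let $A$ be an $n\times n$ complex Hermitian matrix with eigenvalues $\lambda\in\mathbb{R}^n$ and diagonal entries $d\in\mathbb{R}^n$. $A$ is Schur-Horn continuous if the following holds: whenever $\tilde\lambda$ is a perturbation of $\lambda$ such that $\|\lambda-\tilde\lambda\|_2=O(\varepsilon)$ for $\varepsilon>0$ sufficiently small and $\tilde\lambda\prec d$, there exists a complex Hermitian matrix $\widetilde B$ with eigenvalues $\tilde\lambda$ and diagonal entries $d$ such that $\|A-\widetilde B\|_{\mathrm F}=O(\varepsilon^{1/2})$. *)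

(* Defs.v *)
From HB Require Import structures.
From mathcomp Require Import all_boot all_order all_algebra.
From mathcomp Require Import sesquilinear.
From mathcomp Require Import complex.
From mathcomp Require Import all_classical all_reals all_analysis.

Set Implicit Arguments.
Unset Strict Implicit.
Unset Printing Implicit Defensive.

Import Order.TTheory GRing.Theory Num.Theory.
Import numFieldNormedType.Exports.

Local Open Scope classical_set_scope.
Local Open Scope ring_scope.

Definition l2norm (R : realType) (n : nat) (x : 'rV[R]_n) : R :=
  Num.sqrt (\sum_(i < n) x 0 i ^+ 2).

(* [ComplexField.Normc.normc] is the real-valued modulus on [R[i]]; the generic
   norm [`|z|] lives in [R[i]] itself. *)
Definition frobenius_norm (R : realType) (m n : nat) (A : 'M[R[i]]_(m, n)) : R :=
  Num.sqrt (\sum_(i < m) \sum_(j < n) ComplexField.Normc.normc (A i j) ^+ 2).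

Definition sort_up (R : realType) (n : nat) (x : 'rV[R]_n) : seq R :=
  sort <=%R [seq x 0 i | i <- enum 'I_n].

(* The inequality between partial sums of the smallest entries is oriented as
   [\sum lambda <= \sum a], i.e. [a] is the less spread-out vector. *)
Definition majorized_by (R : realType) (n : nat) (lambda a : 'rV[R]_n) : Prop :=
  (forall k : nat, (1 <= k <= n.-1)%N ->
     \sum_(i < k) (sort_up lambda)`_i <= \sum_(i < k) (sort_up a)`_i) /\
  \sum_(i < n) (sort_up lambda)`_i = \sum_(i < n) (sort_up a)`_i.

(* Eigenvalues counted with algebraic multiplicity, listed in any order. *)
Definition has_eigenvalues (R : realType) (n : nat) (A : 'M[R[i]]_n)
    (lambda : 'rV[R]_n) : Prop :=
  char_poly A = \prod_(i < n) ('X - ((lambda 0 i)%:C%C)%:P).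

Definition has_diagonal (R : realType) (n : nat) (A : 'M[R[i]]_n)
    (d : 'rV[R]_n) : Prop :=
  forall i : 'I_n, A i i = (d 0 i)%:C%C.

(* Perturbed quantities are families indexed by [e]; only their values for
   small [e > 0] (filter [0^'+]) matter, so they are taken to be total
   functions of [e]. *)
Definition schur_horn_continuous (R : realType) (n : nat) (A : 'M[R[i]]_n) :
    Prop :=
  forall lambda d : 'rV[R]_n,
    has_eigenvalues A lambda -> has_diagonal A d ->
  forall lambdat : R -> 'rV[R]_n,
    (fun e : R => l2norm (lambda - lambdat e)) =O_ (0^'+) (fun e : R => e) ->
    (\forall e \near 0^'+, majorized_by (lambdat e) d) ->
  exists Bt : R -> 'M[R[i]]_n,
    (\forall e \near 0^'+, [/\ Bt e \is hermsymmx,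
                               has_eigenvalues (Bt e) (lambdat e) &
                               has_diagonal (Bt e) d]) /\
    (fun e : R => frobenius_norm (A - Bt e)) =O_ (0^'+)
      (fun e : R => e `^ 2^-1).

(* Main.v *)
(* Write A = V^* diag(a) V and start from V^* diag(mu) V, with mu the perturbed
   eigenvalues in increasing order: the spectrum is right, and the diagonal is
   wrong by O(eps). It is repaired by plane rotations. Rotating two indices p, q
   moves an amount t of diagonal from p to q, at cost O(t) if A_pq <> 0 and at
   cost O(sqrt t) if A_pp - A_qq > 0.

   Split the indices into the irreducible blocks of A, merging the 1x1 blocks
   with equal entries. First the traces of the blocks are corrected, at cost
   O(sqrt eps), by rotating eigenvectors: trace can flow from one block to
   another as soon as the former has an eigenvalue exceeding some eigenvalue of
   the latter. Listing the eigenvalues increasingly, flow is always possible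
   downwards, and upwards past a position m unless the first m eigenvalues fill
   whole blocks; in that case majorization says that the flow past m must go
   downwards. Then the diagonal is corrected inside each block, at a cost linear
   in the error, i.e. O(sqrt eps): along nonzero entries in an irreducible block,
   and by rotations commuting with A where A is scalar. *)
Require Import Defs.
From mathcomp Require Import all_boot all_order all_algebra.
From mathcomp Require Import sesquilinear spectral ring lra.
From mathcomp Require Import complex.
From mathcomp Require Import all_classical all_reals all_analysis.
Set Implicit Arguments.
Unset Strict Implicit.
Unset Printing Implicit Defensive.
Import Order.TTheory GRing.Theory Num.Theory.
Local Open Scope ring_scope.
Local Open Scope sesquilinear_scope.

(** * Entrywise distance and unitary similarity *)

Section Closeness.
Context {R : realType} {n : nat}.
Local Notation C := R[i].
Implicit Types (M N B U V : 'M[C]_n) (z : C) (e : R).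

Definition dg M (i : 'I_n) : R := complex.Re (M i i).

(** An entrywise distance, equivalent to the Frobenius one up to a factor depending on [n]; it
    behaves well under products and restricts directly to the diagonal. *)
Definition close M B e := forall i j, `|M i j - B i j| <= e%:C%C.

Definition usim M M' :=
  exists2 U : 'M[C]_n, U *m U^t* = 1%:M & M' = U *m M *m U^t*.

Lemma adjE M i j : (M^t*) i j = (M j i)^*.
Proof. by rewrite !mxE. Qed.

Lemma adjM M N : (M *m N)^t* = N^t* *m M^t*.
Proof. by rewrite trmx_mul map_mxM. Qed.

Lemma hermP M : reflect (M^t* = M) (M \is hermsymmx).
Proof.
by apply: (iffP (is_hermitianmxP _ _ _)); rewrite expr0 scale1r => h; exact: esym.
Qed.

Lemma hermE M i j : M \is hermsymmx -> M j i = (M i j)^*.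
Proof. by move/hermP => {1}<-; rewrite adjE. Qed.

Lemma dgE M i : M \is hermsymmx -> M i i = (dg M i)%:C%C.
Proof.
move=> hM; rewrite /dg RRe_real //; apply/CrealP.
by rewrite -hermE.
Qed.

Lemma usim_refl M : usim M M.
Proof. by exists 1%:M; rewrite ?trmx1 ?map_mx1 ?mul1mx ?mulmx1. Qed.

Lemma usim_trans M N P : usim M N -> usim N P -> usim M P.
Proof.
move=> [U hU ->] [V hV ->]; exists (V *m U); rewrite adjM ?mulmxA //.
by rewrite -(mulmxA V) hU mulmx1.
Qed.

Lemma usim_herm M N : usim M N -> M \is hermsymmx -> N \is hermsymmx.
Proof.
move=> [U hU ->] /hermP hM; apply/hermP.
by rewrite !adjM trmxCK hM mulmxA.
Qed.

Lemma usim_char_poly M N : usim M N -> char_poly N = char_poly M.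
Proof.
move=> [U hU ->]; rewrite /char_poly /char_poly_mx.
have hU' := mulmx1C hU.
set f := map_mx polyC.
have e : 'X%:M - f (U *m M *m U^t*) = f U *m ('X%:M - f M) *m f (U^t*).
  rewrite mulmxBr mulmxBl /f !map_mxM; congr (_ - _).
  by rewrite mul_mx_scalar -scalemxAl -map_mxM hU map_mx1 scalemx1.
by rewrite e !det_mulmx mulrAC -det_mulmx /f -map_mxM hU map_mx1 det1 mul1r.
Qed.

Lemma close_trans M N P e1 e2 :
  close M N e1 -> close N P e2 -> close M P (e1 + e2).
Proof.
move=> h1 h2 i j; have -> : M i j - P i j = (M i j - N i j) + (N i j - P i j).
  by ring.
by rewrite rmorphD; apply: le_trans (ler_normD _ _) _; apply: lerD.
Qed.

Lemma closeC M N e : close M N e -> close N M e.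
Proof. by move=> h i j; rewrite distrC. Qed.

Lemma closeW M N e1 e2 : e1 <= e2 -> close M N e1 -> close M N e2.
Proof. by move=> h12 h i j; apply: le_trans (h i j) _; rewrite lecR. Qed.

Lemma close_refl M : close M M 0.
Proof. by move=> i j; rewrite subrr normr0. Qed.

Lemma close_dg M N e i : close M N e -> `|dg M i - dg N i| <= e.
Proof.
move=> /(_ i i); rewrite /dg => h; rewrite -lecR.
have -> : complex.Re (M i i) - complex.Re (N i i) = complex.Re (M i i - N i i).
  by case: (M i i) => ? ?; case: (N i i) => ? ?.
exact: le_trans (normc_ge_Re _) h.
Qed.

Lemma unitary_le1 U i j : U *m U^t* = 1%:M -> `|U i j| <= 1.
Proof.
move=> /matrixP /(_ i i); rewrite !mxE eqxx => h.
rewrite -(@expr_le1 _ 2) // normCK -[leRHS]/(true%:R) -h (bigD1 j) //= adjE lerDl.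
by apply: sumr_ge0 => k _; rewrite adjE -normCK exprn_ge0.
Qed.

Lemma realCMn (x : R) m : x%:C%C *+ m = (m%:R * x)%:C%C :> C.
Proof. by rewrite mulr_natl rmorphMn. Qed.

Lemma mul3_le (P Q S : 'M[C]_n) (a b c : R) i j :
  (forall i j, `|P i j| <= a%:C%C) -> (forall i j, `|Q i j| <= b%:C%C) ->
  (forall i j, `|S i j| <= c%:C%C) ->
  `|(P *m Q *m S) i j| <= (n%:R ^+ 2 * (a * b * c))%:C%C.
Proof.
move=> hP hQ hS; rewrite mxE.
apply: le_trans (ler_norm_sum _ _ _) _.
apply: le_trans (_ : \sum_(k < n) (n%:R * (a * b * c))%:C%C <= _).
  apply: ler_sum => k _; rewrite mxE normrM.
  apply: le_trans (_ : (\sum_(l < n) (a * b)%:C%C) * c%:C%C <= _).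
    apply: ler_pM; [exact: normr_ge0|exact: normr_ge0| |exact: hS].
    apply: le_trans (ler_norm_sum _ _ _) _.
    by apply: ler_sum => l _; rewrite normrM [leRHS]rmorphM; apply: ler_pM;
      [exact: normr_ge0|exact: normr_ge0|exact: hP|exact: hQ].
  by rewrite sumr_const card_ord realCMn -rmorphM lecR !mulrA.
by rewrite sumr_const card_ord realCMn lecR expr2 !mulrA.
Qed.

(** Covers unitaries far from the identity: it serves the change of basis by [V] and the large
    rotations fixing [A]. *)
Lemma close_conj U M N e : U *m U^t* = 1%:M -> close M N e ->
  close (U *m M *m U^t*) (U *m N *m U^t*) (n%:R ^+ 2 * e).
Proof.
move=> hU h i j.
have -> : (U *m M *m U^t*) i j - (U *m N *m U^t*) i j
        = (U *m (M - N) *m U^t*) i j by rewrite mulmxBr mulmxBl !mxE.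
have := @mul3_le U (M - N) (U^t*) 1 e 1 i j; rewrite mul1r mulr1; apply.
- by move=> k l; exact: unitary_le1.
- by move=> k l; rewrite !mxE; exact: h.
- by move=> k l; rewrite adjE norm_conjC; exact: unitary_le1.
Qed.

(** Telescoping: U M U^* - M = (U - 1) M U^* + M (U - 1)^*, and a unitary matrix has entries of
    modulus at most 1. *)
Lemma close_rot U M r b : U *m U^t* = 1%:M ->
  close U 1%:M r -> (forall i j, `|M i j| <= b%:C%C) ->
  close (U *m M *m U^t*) M (2 * n%:R ^+ 2 * (r * b)).
Proof.
move=> hU hr hb i j.
have -> : (U *m M *m U^t*) i j - M i j =
   ((U - 1%:M) *m M *m U^t*) i j + (1%:M *m M *m (U - 1%:M)^t*) i j.
  rewrite !mulmxBl mul1mx linearB /= map_mxB trmx1 map_mx1 mulmxBr mulmx1.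
  by rewrite !mxE; ring.
apply: le_trans (ler_normD _ _) _.
have -> : (2 * n%:R ^+ 2 * (r * b))%:C%C =
  (n%:R ^+ 2 * (r * b * 1))%:C%C + (n%:R ^+ 2 * (1 * b * r))%:C%C :> C.
  by rewrite -rmorphD /=; congr _%:C%C; ring.
apply: lerD; apply: mul3_le => // k l.
- by rewrite !mxE; have := hr k l; rewrite !mxE.
- by rewrite adjE norm_conjC; exact: unitary_le1.
- by rewrite mxE; case: (k == l); rewrite ?normr1 ?normr0.
- by rewrite adjE norm_conjC; have := hr l k; rewrite !mxE.
Qed.

Lemma mx_bound B : exists2 b : R, 0 <= b & forall i j, `|B i j| <= b%:C%C.
Proof.
exists (complex.Re (\sum_i \sum_j `|B i j|)).
  rewrite -lecR RRe_real ?ger0_real //; by do 2!apply: sumr_ge0 => ? _.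
move=> i j; rewrite RRe_real; last first.
  by rewrite ger0_real //; do 2!apply: sumr_ge0 => ? _.
rewrite (bigD1 i) //= (bigD1 j) //= -addrA lerDl addr_ge0 //.
  exact: sumr_ge0.
by apply: sumr_ge0 => ? _; apply: sumr_ge0.
Qed.

Lemma close_bound M B e b : close M B e -> (forall i j, `|B i j| <= b%:C%C) ->
  forall i j, `|M i j| <= (b + e)%:C%C.
Proof.
move=> h hb i j; rewrite -[M i j](subrK (B i j)) addrC rmorphD.
by apply: le_trans (ler_normD _ _) _; apply: lerD.
Qed.

End Closeness.

(** * Plane rotations and their effect on the diagonal *)

Section Rotation.
Context {R : realType} {n : nat}.
Local Notation C := R[i].
Implicit Types (M B : 'M[C]_n) (w z : C).

Definition sqnorm w : R := complex.Re w ^+ 2 + complex.Im w ^+ 2.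

Lemma sqnorm_ge0 w : 0 <= sqnorm w.
Proof. by rewrite addr_ge0 ?sqr_ge0. Qed.

Lemma sqnormE w : (sqnorm w)%:C%C = w * w^*.
Proof. by rewrite /sqnorm add_Re2_Im2 normCK. Qed.

Definition rot_cos w : R := (Num.sqrt (1 + sqnorm w))^-1.

Lemma rot_cos_sqr w : rot_cos w ^+ 2 = (1 + sqnorm w)^-1.
Proof. by rewrite exprVn sqr_sqrtr // addr_ge0 ?sqnorm_ge0. Qed.

Lemma rot_cos_gt0 w : 0 < rot_cos w.
Proof. by rewrite invr_gt0 sqrtr_gt0 ltr_pwDl ?sqnorm_ge0. Qed.

Lemma rot_cos_mul w : rot_cos w ^+ 2 * (1 + sqnorm w) = 1.
Proof. by rewrite rot_cos_sqr mulVf // gt_eqF // ltr_pwDl ?sqnorm_ge0. Qed.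

Lemma rot_cosE w : (rot_cos w)%:C%C * (rot_cos w)%:C%C * (1 + w * w^*) = 1 :> C.
Proof.
have := congr1 (real_complex R) (rot_cos_mul w).
by rewrite rmorphM rmorphXn rmorphD rmorph1 /= sqnormE expr2.
Qed.

Lemma rot_cos_le1 w : rot_cos w <= 1.
Proof.
rewrite invf_le1 ?sqrtr_gt0 ?ltr_pwDl ?sqnorm_ge0 //.
by rewrite -[leLHS]sqrtr1 ler_wsqrtr // lerDl sqnorm_ge0.
Qed.

Lemma rot_cos_ge w (r : R) : 0 <= r -> sqnorm w <= r ^+ 2 -> 1 - r <= rot_cos w.
Proof.
move=> r0 hr; rewrite leNgt; apply/negP => hlt.
have := rot_cos_mul w; have := rot_cos_gt0 w; have := sqnorm_ge0 w.
move: (rot_cos w) (sqnorm w) hr hlt => c s hr hlt s0 c0 h.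
(* If c < 1 - r, then c^2 (1 + r^2) <= c (1 - r) (1 + r^2) <= c < 1, whereas c^2 (1 + r^2) >= c^2 (1
   + s) = 1. *)
have h1 : c ^+ 2 * (1 + s) <= c ^+ 2 * (1 + r ^+ 2).
  by rewrite ler_wpM2l ?sqr_ge0 // lerD2l.
have h2 : (1 - r) * (1 + r ^+ 2) <= 1 by nra.
have h3 : c * (1 + r ^+ 2) <= (1 - r) * (1 + r ^+ 2).
  by rewrite ler_wpM2r ?addr_ge0 ?sqr_ge0 // ltW.
by nra.
Qed.

(* In the plane of the indices [p], [q] the rows are [(1, w)] and [(- w^*, 1)],
   both divided by [sqrt (1 + |w|^2)]: [|w|] is the tangent of the angle. *)
Definition rot (p q : 'I_n) w : 'M[C]_n := \matrix_(k, l)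
  if k == p then (rot_cos w)%:C%C * ((p == l)%:R + w * (q == l)%:R)
  else if k == q then (rot_cos w)%:C%C * ((q == l)%:R - w^* * (p == l)%:R)
  else (k == l)%:R.

Lemma sum_delta (p : 'I_n) (f : 'I_n -> C) : \sum_l (p == l)%:R * f l = f p.
Proof.
rewrite (bigD1 p) //= eqxx mul1r big1 ?addr0 // => l.
by rewrite eq_sym => /negbTE ->; rewrite mul0r.
Qed.

Lemma rot_mulE p q w M k l : (rot p q w *m M) k l =
  if k == p then (rot_cos w)%:C%C * (M p l + w * M q l)
  else if k == q then (rot_cos w)%:C%C * (M q l - w^* * M p l)
  else M k l.
Proof.
rewrite mxE; set c := (rot_cos w)%:C%C.
case: (eqVneq k p) => [kp|kp].
  rewrite (eq_bigr (fun j => c * ((p == j)%:R * M j l)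
                           + c * w * ((q == j)%:R * M j l))); last first.
    by move=> j _; rewrite mxE kp eqxx; ring.
  by rewrite big_split /= -!mulr_sumr !sum_delta; ring.
case: (eqVneq k q) => [kq|kq].
  rewrite (eq_bigr (fun j => c * ((q == j)%:R * M j l)
                           + c * (- w^* ) * ((p == j)%:R * M j l))); last first.
    by move=> j _; rewrite mxE (negbTE kp) kq eqxx -/c; ring.
  by rewrite big_split /= -!mulr_sumr !sum_delta; ring.
rewrite (eq_bigr (fun j => (k == j)%:R * M j l)) ?sum_delta // => j _.
by rewrite mxE (negbTE kp) (negbTE kq).
Qed.

Lemma mul_rotE p q w M k l : (M *m (rot p q w)^t*) k l =
  if l == p then (rot_cos w)%:C%C * (M k p + w^* * M k q)
  else if l == q then (rot_cos w)%:C%C * (M k q - w * M k p)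
  else M k l.
Proof.
have -> : M *m (rot p q w)^t* = (rot p q w *m M^t*)^t* by rewrite adjM trmxCK.
rewrite adjE rot_mulE !adjE.
have hc : ((rot_cos w)%:C%C)^* = (rot_cos w)%:C%C :> C.
  by apply/CrealP; rewrite complex_real.
have hM (x y : C) : (x * y)^* = x^* * y^* by rewrite rmorphM.
have hD (x y : C) : (x + y)^* = x^* + y^* by rewrite rmorphD.
have hN (x : C) : (- x)^* = - x^* by rewrite rmorphN.
by case: eqP => _; [|case: eqP => _]; rewrite ?hM ?hD ?hN ?hM !conjCK ?hc.
Qed.

Lemma rot_unitary p q w : p != q -> rot p q w *m (rot p q w)^t* = 1%:M.
Proof.
move=> pq; have qp : q != p by rewrite eq_sym.
apply/matrixP => k l; rewrite mul_rotE !mxE !(eq_sym _ l).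
have := rot_cosE w; set c := (_%:C)%C => hw.
have [?|kp] := eqVneq k p; have [?|lp] := eqVneq l p; subst;
  rewrite ?eqxx ?(negbTE pq) ?(negbTE qp) ?(negbTE kp) ?(negbTE lp) //=.
- by rewrite -[RHS]hw; ring.
- have [_|lq] := eqVneq l q; rewrite ?eqxx ?(negbTE pq) ?(negbTE qp) /=; ring.
- have [_|kq] := eqVneq k q; rewrite ?eqxx ?(negbTE pq) ?(negbTE qp)
    ?(eq_sym p k) ?(negbTE kp) ?(eq_sym q k) ?(negbTE kq) /=; ring.
have [?|kq] := eqVneq k q; have [?|lq] := eqVneq l q; subst;
  rewrite ?eqxx ?(negbTE pq) ?(negbTE qp) ?(negbTE kq) ?(negbTE lq)
    ?(negbTE kp) ?(negbTE lp) //=.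
- by rewrite -[RHS]hw; ring.
- by ring.
- by rewrite ?(eq_sym p k) ?(eq_sym q k) ?(negbTE kp) ?(negbTE kq) /=; ring.
Qed.

Lemma le_sqnorm w (r : R) : 0 <= r -> (`|w| <= r%:C%C) = (sqnorm w <= r ^+ 2).
Proof.
move=> r0; rewrite -(@ler_pXn2r _ 2) ?nnegrE ?normr_ge0 ?lecR //.
by rewrite -add_Re2_Im2 -rmorphXn /= lecR.
Qed.

Lemma rot_close p q w (r : R) : p != q -> 0 <= r -> sqnorm w <= r ^+ 2 ->
  close (rot p q w) 1%:M r.
Proof.
move=> pq r0 hw k l; rewrite !mxE.
have h1 : `|(rot_cos w)%:C%C - 1| <= r%:C%C :> C.
  rewrite -[1](rmorph1 (real_complex R)) -rmorphB le_sqnorm // /sqnorm /=.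
  have := rot_cos_ge r0 hw; have := rot_cos_le1 w.
  by move: (rot_cos w) => c *; rewrite expr0n /= addr0; nra.
have h2 v : `|v| <= r%:C%C -> `|(rot_cos w)%:C%C * v| <= r%:C%C :> C.
  move=> hv; rewrite normrM; apply: le_trans hv; rewrite ler_piMl ?normr_ge0 //.
  rewrite -[1](rmorph1 (real_complex R)) le_sqnorm //.
  have := rot_cos_gt0 w; have := rot_cos_le1 w.
  by rewrite /sqnorm /=; move: (rot_cos w) => c *; rewrite expr0n /= addr0; nra.
have h3 : `|w| <= r%:C%C by rewrite le_sqnorm.
have h0 : `|0 : C| <= r%:C%C by rewrite normr0 lecR.
have qp : q != p by rewrite eq_sym.
have [->|kp] := eqVneq k p.
  have [<-|lp] := eqVneq p l; first by rewrite (negbTE qp) mulr0 addr0 mulr1.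
  rewrite subr0 add0r; apply: h2.
  by case: (q == l); rewrite ?mulr1 ?mulr0.
have [->|kq] := eqVneq k q.
  have [<-|lq] := eqVneq q l; first by rewrite (negbTE pq) mulr0 subr0 mulr1.
  rewrite subr0 add0r -mulNr; apply: h2.
  by case: (p == l); rewrite ?mulr1 ?mulr0 // normrN norm_conjC.
by rewrite subrr.
Qed.

(** The quadratic form of [M] evaluated at the unit row proportional to e_p + w e_q. *)
Lemma dg_rot p q w M : p != q -> M \is hermsymmx ->
  dg (rot p q w *m M *m (rot p q w)^t*) p =
    (dg M p + sqnorm w * dg M q + 2 * complex.Re (w * M q p)) / (1 + sqnorm w).
Proof.
move=> pq hM; rewrite mulrC -rot_cos_sqr.
set x := _ * _; have -> // : dg (rot p q w *m M *m (rot p q w)^t*) p = complex.Re (x%:C%C).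
congr complex.Re; rewrite mul_rotE eqxx !rot_mulE eqxx (dgE p hM) (dgE q hM).
rewrite (hermE q p hM) /x rmorphM rmorphXn !rmorphD !rmorphM /= sqnormE.
rewrite rmorph_nat -addcJ.
have -> : ((w * M q p)^*)%C = w^* * (M q p)^* by rewrite -rmorphM.
by ring.
Qed.

Lemma dg_rot_sum p q w M : p != q ->
  dg (rot p q w *m M *m (rot p q w)^t*) p +
  dg (rot p q w *m M *m (rot p q w)^t*) q = dg M p + dg M q.
Proof.
move=> pq; have ReD (x y : C) : complex.Re x + complex.Re y = complex.Re (x + y).
  by case: x; case: y.
rewrite /dg !ReD; congr complex.Re.
rewrite !mul_rotE !rot_mulE !eqxx eq_sym (negbTE pq).
rewrite -[RHS]mul1r -(rot_cosE w).
by ring.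
Qed.

Lemma dg_rot_other p q w M k : k != p -> k != q ->
  dg (rot p q w *m M *m (rot p q w)^t*) k = dg M k.
Proof.
by move=> kp kq; rewrite /dg mul_rotE (negbTE kp) (negbTE kq) rot_mulE (negbTE kp) (negbTE kq).
Qed.

(** [B] is scalar on the plane of [p], [q] and decoupled from the other indices, so it commutes with
    the rotation whatever its angle. *)
Lemma rot_fix p q w B : p != q -> B p p = B q q -> B p q = 0 -> B q p = 0 ->
  (forall k, k != p -> k != q -> [/\ B p k = 0, B q k = 0, B k p = 0 & B k q = 0]) ->
  rot p q w *m B *m (rot p q w)^t* = B.
Proof.
move=> pq hpp hpq hqp hk; apply/matrixP => k l.
rewrite mul_rotE !rot_mulE.
have := rot_cosE w; set c := (_%:C)%C => hw.
have [?|kp] := eqVneq k p; have [?|lp] := eqVneq l p; subst.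
- rewrite hpq hqp -hpp -[RHS]mul1r -hw; ring.
- have [?|lq] := eqVneq l q; subst; first by rewrite hqp hpq hpp; ring.
  by have [-> -> _ _] := hk _ lp lq; ring.
- have [?|kq] := eqVneq k q; subst; first by rewrite hqp hpq hpp; ring.
  by have [_ _ -> ->] := hk _ kp kq; ring.
have [?|kq] := eqVneq k q; have [?|lq] := eqVneq l q; subst.
- rewrite hpq hqp hpp -[RHS]mul1r -hw; ring.
- by have [-> -> _ _] := hk _ lp lq; ring.
- by have [_ _ -> ->] := hk _ kp kq; ring.
- by [].
Qed.

(** Used to choose the argument of [w] in a rotation: x u makes the cross term Re (w M_qp) equal to
    x |M_qp|, and i x u makes it vanish. *)
Lemma phase z : exists2 u : C, sqnorm u = 1 & u * z = (Num.sqrt (sqnorm z))%:C%C.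
Proof.
have [->|z0] := eqVneq z 0.
  exists 1; first by rewrite /sqnorm /= expr0n addr0 expr1n.
  by rewrite mulr0 /sqnorm /= expr0n addr0 sqrtr0.
have hz : sqnorm z != 0.
  apply: contra z0 => /eqP h; rewrite -normr_eq0 -sqrf_eq0 -add_Re2_Im2.
  by rewrite -/(sqnorm z) h.
have hz0 : 0 < sqnorm z by rewrite lt_neqAle eq_sym hz sqnorm_ge0.
have hs : Num.sqrt (sqnorm z) != 0 by rewrite gt_eqF // sqrtr_gt0.
exists ((Num.sqrt (sqnorm z))^-1%:C%C * z^*).
  have e : ((sqnorm ((Num.sqrt (sqnorm z))^-1%:C%C * z^*)))%:C%C = 1%:C%C :> C.
    rewrite sqnormE -normCK normrM norm_conjC exprMn -!add_Re2_Im2.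
    rewrite -/(sqnorm z) -rmorphM /= expr0n addr0 exprVn.
    by rewrite sqr_sqrtr ?sqnorm_ge0 // mulVf.
  by case: e.
rewrite -mulrA [_ * z]mulrC -sqnormE -rmorphM; congr (_%:C)%C.
by rewrite -[X in _ * X]sqr_sqrtr ?sqnorm_ge0 // expr2 mulrA mulVf // mul1r.
Qed.

(** The equation on [w] is [dg M' p = dg M p - t] with the denominator of [dg_rot] cleared;
    invariance of the trace on the plane then gives the entry at [q]. *)
Lemma rot_step M p q w (r b t : R) : p != q -> M \is hermsymmx ->
  0 <= r -> sqnorm w <= r ^+ 2 -> (forall i j, `|M i j| <= b%:C%C) ->
  sqnorm w * (dg M q - dg M p + t) + 2 * complex.Re (w * M q p) + t = 0 ->
  let M' := rot p q w *m M *m (rot p q w)^t* in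
  [/\ usim M M', close M' M (2 * n%:R ^+ 2 * (r * b)) &
      forall k, dg M' k = dg M k + t * ((q == k)%:R - (p == k)%:R)].
Proof.
move=> pq hM r0 hr hb ht M'; have hU := rot_unitary w pq; split.
- by exists (rot p q w).
- by apply: close_rot => //; apply: rot_close.
have hp : dg M' p = dg M p - t.
  rewrite dg_rot //; apply: (canLR (mulfK _)).
    by rewrite gt_eqF // ltr_pwDl ?sqnorm_ge0.
  by move: ht; move: (sqnorm w) (complex.Re _) => s x ht; lra.
move=> k; have [<-|pk] := eqVneq p k.
  by rewrite hp ?eqxx (eq_sym q p) (negbTE pq) /=; ring.
have [<-|qk] := eqVneq q k.
  by apply: (addrI (dg M' p)); rewrite dg_rot_sum // hp ?eqxx /=; ring.
by rewrite /M' dg_rot_other 1?eq_sym //=; ring.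
Qed.

End Rotation.

(** * Moving diagonal mass near a fixed matrix *)

Section Reach.
Context {R : realType} {n : nat}.
Local Notation C := R[i].
Variables (k : nat) (B : 'M[C]_n) (lab : 'I_n -> 'I_n).
Implicit Types (M N : 'M[C]_n) (p q l : 'I_n).

Definition blocksum M l : R := \sum_(i | lab i == l) dg M i.

(* Near [B], an amount [t <= s ^+ k] of diagonal can be moved from the block of
   [p] to that of [q] at cost [O(s)]: [k = 1] is the first-order move along a
   nonzero entry, [k = 2] the second-order one along a gap of the diagonal. *)
Definition reach p q := exists c e : R, [/\ 0 <= c, 0 < e &
  forall M, M \is hermsymmx -> close M B e ->
  forall s t : R, 0 <= s <= e -> 0 <= t <= s ^+ k ->
  exists M', [/\ usim M M', close M' M (c * s) & forall l,
    blocksum M' l = blocksum M l + t * ((lab q == l)%:R - (lab p == l)%:R)]].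

Lemma reach_same p q : lab p = lab q -> reach p q.
Proof.
move=> pq; exists 0, 1; split=> // M hM _ s t _ _; exists M; split.
- exact: usim_refl.
- by rewrite mul0r; exact: close_refl.
- by move=> l; rewrite pq subrr mulr0 addr0.
Qed.

Lemma reach_trans p q r : reach p q -> reach q r -> reach p r.
Proof.
move=> [c1 [e1 [c10 e10 h1]]] [c2 [e2 [c20 e20 h2]]].
(* After the first move the distance to [B] is at most e + c1 s <= e (1 + c1), which must stay
   within [e2] for the second move. *)
exists (c1 + c2), (Num.min e1 (e2 / (1 + c1))); split; first exact: addr_ge0.
  by rewrite lt_min e10 divr_gt0 // ltr_pwDl.
set e := Num.min _ _ => M hM hMB s t /andP[s0 se] ht.
have ee1 : e <= e1 by rewrite ge_min lexx.
have ee2 : e * (1 + c1) <= e2.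
  by rewrite -ler_pdivlMr ?ltr_pwDl // ge_min lexx orbT.
have [||M1 [u1 d1 b1]] := h1 M hM _ s t _ ht.
- exact: closeW hMB.
- by rewrite s0 (le_trans se).
have [||M2 [u2 d2 b2]] := h2 M1 (usim_herm u1 hM) _ s t _ ht.
- apply: closeW (close_trans d1 hMB); apply: le_trans ee2.
  by rewrite mulrDr mulr1 addrC lerD2l mulrC ler_wpM2r.
- by rewrite s0 (le_trans _ ee2) // (le_trans se) // ler_peMr ?lerDl // (le_trans s0).
exists M2; split; first exact: usim_trans u2.
  by rewrite mulrDl addrC; exact: close_trans d1.
by move=> l; rewrite b2 b1; ring.
Qed.

Lemma sum_lab_delta q l : \sum_(i | lab i == l) ((q == i)%:R : R) = (lab q == l)%:R.
Proof.
rewrite big_mkcond (bigD1 q) //= eqxx big1 => [|i]; last first.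
  by rewrite eq_sym => /negbTE ->; case: ifP.
by rewrite addr0; case: (lab q == l).
Qed.

Lemma blocksum_move M M' p q (t : R) :
  (forall i, dg M' i = dg M i + t * ((q == i)%:R - (p == i)%:R)) ->
  forall l, blocksum M' l = blocksum M l + t * ((lab q == l)%:R - (lab p == l)%:R).
Proof.
move=> h l; rewrite /blocksum (eq_bigr _ (fun i _ => h i)) big_split /=.
by rewrite -mulr_sumr sumrB !sum_lab_delta.
Qed.

End Reach.

(** * The two elementary moves: along a gap and along an edge *)

Section ReachFacts.
Context {R : realType} {n : nat}.
Local Notation C := R[i].
Variables (B : 'M[C]_n) (lab : 'I_n -> 'I_n).
Hypothesis hB : B \is hermsymmx.
Implicit Types (M N : 'M[C]_n) (p q l : 'I_n).

Lemma sqnormM (x y : C) : sqnorm (x * y) = sqnorm x * sqnorm y.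
Proof. by case: x => a b; case: y => c d; rewrite /sqnorm /=; ring. Qed.

Lemma sqnorm_real (x : R) : sqnorm (x%:C%C : C) = x ^+ 2.
Proof. by rewrite /sqnorm /= expr0n addr0. Qed.

(** With the argument of [w] chosen to kill the cross term, the equation of [rot_step] reads |w|^2 D
    = t with D = M_pp - M_qq - t. The gap bounds D from below, so |w| is O(sqrt t) = O(s). *)
Lemma reach_gap p q : dg B q < dg B p -> reach 2 B lab p q.
Proof.
move=> hgap; pose g := dg B p - dg B q.
have g0 : 0 < g by rewrite subr_gt0.
have [b b0 hb] := mx_bound B.
have pq : p != q by apply: contraTneq hgap => ->; rewrite ltxx.
(* Two diagonal errors of at most e and t <= s^2 <= e leave D >= g - 3 e >= g / 4. *)
pose e := Num.min 1 (g / 4).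
have e0 : 0 < e by rewrite lt_min ltr01 divr_gt0.
have e1 : e <= 1 by rewrite ge_min lexx.
have eg : e <= g / 4 by rewrite ge_min lexx orbT.
have sg0 : 0 < Num.sqrt g by rewrite sqrtr_gt0.
exists (2 * n%:R ^+ 2 * (2 / Num.sqrt g * (b + e))), e; split => //.
  by rewrite !mulr_ge0 ?exprn_ge0 ?invr_ge0 ?(ltW sg0) ?addr_ge0 ?(ltW e0).
move=> M hM hMB s t /andP[s0 se] /andP[t0 ts].
have hbM := close_bound hMB hb.
have te : t <= e by apply: (le_trans ts); rewrite expr2; nra.
have := close_dg p hMB; have := close_dg q hMB; rewrite !ler_norml => /andP[q1 q2] /andP[p1 p2].
pose D := dg M p - dg M q - t.
have hD : g / 4 <= D by rewrite /D; move: eg; rewrite /g; lra.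
have D0 : 0 < D by apply: lt_le_trans hD; rewrite divr_gt0.
have [u hu1 hu] := phase (M q p).
pose w := 'i%C * (Num.sqrt (t / D))%:C%C * u.
have hw : sqnorm w = t / D.
  rewrite !sqnormM hu1 sqnorm_real sqr_sqrtr ?divr_ge0 // ?(ltW D0) //.
  by rewrite /sqnorm /= expr0n expr1n add0r mul1r mulr1.
have [||||U cl dgE] := @rot_step _ _ M p q w (2 / Num.sqrt g * s) (b + e) t pq hM.
- by rewrite !mulr_ge0 ?invr_ge0 ?(ltW sg0).
- rewrite hw !exprMn exprVn sqr_sqrtr ?(ltW g0) //.
  rewrite ler_pdivrMr //; apply: (le_trans ts).
  have -> : 2 ^+ 2 / g * s ^+ 2 * D = (s ^+ 2 * D) * (4 / g) by ring.
  rewrite -ler_pdivrMr; last by rewrite divr_gt0.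
  by rewrite invf_div ler_wpM2l ?sqr_ge0.
- exact: hbM.
- rewrite hw /w -!mulrA hu.
  have -> : complex.Re ('i%C * ((Num.sqrt (t / D))%:C%C * (Num.sqrt (sqnorm (M q p)))%:C%C)) = 0.
    by rewrite /=; ring.
  have -> : dg M q - dg M p + t = - D by rewrite /D; ring.
  by field; rewrite gt_eqF.
exists (rot p q w *m M *m (rot p q w)^t*); split => //.
  by apply: closeW cl; rewrite le_eqVlt; apply/orP; left; apply/eqP; ring.
exact: blocksum_move.
Qed.

(** The root of h x^2 + 2 m x + t that is small with t, in the rationalised form - t / (m + d),
    which also covers h = 0. *)
Lemma quadratic_root (m0 m h t : R) : 0 < m0 -> m0 <= m -> 0 <= t -> t * h <= m ^+ 2 ->
  exists2 x : R, x ^+ 2 * h + 2 * x * m + t = 0 & x ^+ 2 <= (t / m0) ^+ 2.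
Proof.
move=> m00 m0m t0 ht; pose d := Num.sqrt (m ^+ 2 - t * h).
have d0 : 0 <= d by rewrite sqrtr_ge0.
have d2 : d ^+ 2 = m ^+ 2 - t * h by rewrite sqr_sqrtr // subr_ge0.
have md : 0 < m + d by apply: ltr_pwDl => //; apply: lt_le_trans m0m.
exists (- t / (m + d)).
  have -> : (- t / (m + d)) ^+ 2 * h + 2 * (- t / (m + d)) * m + t
          = t * (d ^+ 2 - (m ^+ 2 - t * h)) / (m + d) ^+ 2 by field; rewrite gt_eqF.
  by rewrite d2 subrr mulr0 mul0r.
rewrite mulNr sqrrN ler_pXn2r ?nnegrE ?divr_ge0 ?(ltW md) ?(ltW m00) //.
rewrite ler_wpM2l // lef_pV2 ?posrE // (le_trans m0m) // lerDl //.
Qed.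

(** Here the cross term does the work: with w = x u it is x |M_qp|, and |M_qp| stays bounded away
    from 0 near [B], so the root x is O(t). *)
Lemma reach_edge p q : p != q -> B p q != 0 -> reach 1 B lab p q.
Proof.
move=> pq hpq; have [b b0 hb] := mx_bound B.
pose m0 := Num.sqrt (sqnorm (B q p)).
have m0E (z : C) : `|z| = (Num.sqrt (sqnorm z))%:C%C by rewrite normc_def.
have m00 : 0 < m0.
  rewrite -ltcR -m0E normr_gt0 (hermE p q hB).
  by rewrite conjC_eq0.
(* The second bound keeps |M_qp| >= m0 / 2. The third makes the discriminant nonnegative, as the
   leading coefficient is at most 2 (b + e) + t <= 2 b + 3. *)
pose e := Num.min 1 (Num.min (m0 / 2) (m0 ^+ 2 / 4 / (2 * b + 3))).
have hb3 : 0 < 2 * b + 3 by lra.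
have e0 : 0 < e by rewrite !lt_min ltr01 !divr_gt0 // exprn_gt0.
have e1 : e <= 1 by rewrite ge_min lexx.
have e2 : e <= m0 / 2 by rewrite !ge_min lexx orbT.
have e3 : e * (2 * b + 3) <= m0 ^+ 2 / 4.
  by rewrite -ler_pdivlMr // !ge_min lexx !orbT.
exists (2 * n%:R ^+ 2 * (2 / m0 * (b + e))), e; split => //.
  by rewrite !mulr_ge0 ?exprn_ge0 ?invr_ge0 ?(ltW m00) ?addr_ge0 ?(ltW e0).
move=> M hM hMB s t /andP[s0 se]; rewrite expr1 => /andP[t0 ts].
have hbM := close_bound hMB hb.
pose m := Num.sqrt (sqnorm (M q p)).
have hm : m0 / 2 <= m.
  have : m0%:C%C <= (m + e)%:C%C :> C.
    rewrite /m0 -m0E rmorphD /= -m0E -[B q p](subrK (M q p)) addrC.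
    by apply: le_trans (ler_normD _ _) _; rewrite lerD2l distrC.
  by rewrite lecR; lra.
have hd i : - (b + e) <= dg M i <= b + e.
  rewrite -ler_norml -lecR; apply: le_trans (hbM i i); exact: normc_ge_Re.
have [x hx1 hx2] : exists2 x : R, x ^+ 2 * (dg M q - dg M p + t) + 2 * x * m + t = 0
    & x ^+ 2 <= (t / (m0 / 2)) ^+ 2.
  apply: quadratic_root => //; first by rewrite divr_gt0.
  have /andP[q1 q2] := hd q; have /andP[p1 p2] := hd p.
  have h1 : t * (dg M q - dg M p + t) <= e * (2 * b + 3).
    apply: le_trans (_ : t * (2 * b + 3) <= _); first by apply: ler_wpM2l => //; lra.
    by rewrite ler_wpM2r ?(ltW hb3) // (le_trans ts).
  apply: (le_trans h1); apply: (le_trans e3).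
  have : (m0 / 2) ^+ 2 <= m ^+ 2 by rewrite ler_pXn2r // nnegrE ?divr_ge0 ?sqrtr_ge0 // ltW.
  by lra.
have [u hu1 hu] := phase (M q p).
pose w := x%:C%C * u.
have hw : sqnorm w = x ^+ 2 by rewrite sqnormM hu1 sqnorm_real mulr1.
have [||||U cl dgE] := @rot_step _ _ M p q w (2 / m0 * s) (b + e) t pq hM.
- by rewrite !mulr_ge0 ?invr_ge0 ?(ltW m00).
- rewrite hw; apply: (le_trans hx2).
  have -> : t / (m0 / 2) = 2 / m0 * t by field; rewrite gt_eqF.
  by rewrite ler_pXn2r ?nnegrE ?mulr_ge0 ?invr_ge0 ?(ltW m00) //
    ler_wpM2l ?mulr_ge0 ?invr_ge0 ?(ltW m00).
- exact: hbM.
- rewrite hw /w -!mulrA hu -/m.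
  have -> : complex.Re (x%:C%C * m%:C%C) = x * m by rewrite /=; ring.
  by rewrite -[RHS]hx1; ring.
exists (rot p q w *m M *m (rot p q w)^t*); split => //.
  by apply: closeW cl; rewrite le_eqVlt; apply/orP; left; apply/eqP; ring.
exact: blocksum_move.
Qed.

End ReachFacts.

(** * Combining signed moves into a flow *)

Section Flow.
Context {R : realType} {n : nat}.
Local Notation C := R[i].
Variables (k : nat) (B : 'M[C]_n) (lab : 'I_n -> 'I_n).
Implicit Types (M N : 'M[C]_n) (p q l : 'I_n).
Local Notation reach := (reach k B lab).
Local Notation bs := (blocksum lab).

Lemma reach_signed p q : exists c e : R, [/\ 0 <= c, 0 < e &
  forall M, M \is hermsymmx -> close M B e ->
  forall s y : R, 0 <= s <= e -> `|y| <= s ^+ k ->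
  (0 < y -> reach p q) -> (y < 0 -> reach q p) ->
  exists M', [/\ usim M M', close M' M (c * s) & forall l,
    bs M' l = bs M l + y * ((lab q == l)%:R - (lab p == l)%:R)]].
Proof.
(* Whether [reach] holds is decided classically, so that constants are available before the sign of
   [y] is known; where it fails, arbitrary ones do. *)
have opt p' q' : exists c e : R, [/\ 0 <= c, 0 < e &
  reach p' q' -> forall M, M \is hermsymmx -> close M B e ->
  forall s t : R, 0 <= s <= e -> 0 <= t <= s ^+ k ->
  exists M', [/\ usim M M', close M' M (c * s) & forall l,
    bs M' l = bs M l + t * ((lab q' == l)%:R - (lab p' == l)%:R)]].
  have [[c [e [c0 e0 h]]]|nr] := pselect (reach p' q'); first by exists c, e.
  by exists 0, 1.
have [c1 [e1 [c10 e10 h1]]] := opt p q; have [c2 [e2 [c20 e20 h2]]] := opt q p.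
exists (c1 + c2), (Num.min e1 e2); split; [exact: addr_ge0|by rewrite lt_min e10|].
move=> M hM hMB s y /andP[s0 se] hy hpos hneg.
have le1 : Num.min e1 e2 <= e1 by rewrite ge_min lexx.
have le2 : Num.min e1 e2 <= e2 by rewrite ge_min lexx orbT.
case: (ltrgt0P y) => y0.
- have [|||M' [u cl b]] := h1 (hpos y0) M hM _ s y.
  + exact: closeW hMB.
  + by rewrite s0 (le_trans se).
  + by rewrite (ltW y0) (le_trans (ler_norm _)).
  exists M'; split => //; apply: closeW cl.
  by rewrite ler_wpM2r // lerDl.
- have [|||M' [u cl b]] := h2 (hneg y0) M hM _ s (- y).
  + exact: closeW hMB.
  + by rewrite s0 (le_trans se).
  + by rewrite oppr_ge0 (ltW y0) (le_trans _ hy) // -normrN ler_norm.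
  exists M'; split => //; last by move=> l; rewrite b; ring.
  by apply: closeW cl; rewrite ler_wpM2r // lerDr.
exists M; split; first exact: usim_refl.
  by apply: closeW (close_refl M); rewrite mulr_ge0 ?addr_ge0.
by move=> l; rewrite y0 mul0r addr0.
Qed.

(** The pairs are treated one after the other; each move starts from a matrix already displaced by
    O(s), so the radius shrinks as in [reach_trans]. *)
Lemma flow_seq (L : seq ('I_n * 'I_n)) : exists c e : R, [/\ 0 <= c, 0 < e &
  forall M, M \is hermsymmx -> close M B e ->
  forall (s : R) (y : 'I_n -> 'I_n -> R), 0 <= s <= e ->
  (forall p q, `|y p q| <= s ^+ k) ->
  (forall p q, 0 < y p q -> reach p q) -> (forall p q, y p q < 0 -> reach q p) ->
  exists M', [/\ usim M M', close M' M (c * s) & forall l,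
    bs M' l = bs M l
      + \sum_(x <- L) y x.1 x.2 * ((lab x.2 == l)%:R - (lab x.1 == l)%:R)]].
Proof.
elim: L => [|[p q] L [c1 [e1 [c10 e10 h1]]]].
  exists 0, 1; split=> // M hM _ s y _ _ _ _; exists M; split.
  - exact: usim_refl.
  - by rewrite mul0r; exact: close_refl.
  - by move=> l; rewrite big_nil addr0.
have [c2 [e2 [c20 e20 h2]]] := reach_signed p q.
exists (c1 + c2), (Num.min e1 (e2 / (1 + c1))); split; first exact: addr_ge0.
  by rewrite lt_min e10 divr_gt0 // ltr_pwDl.
set e := Num.min _ _ => M hM hMB s y /andP[s0 se] hy hpos hneg.
have ee1 : e <= e1 by rewrite ge_min lexx.
have ee2 : e * (1 + c1) <= e2.
  by rewrite -ler_pdivlMr ?ltr_pwDl // ge_min lexx orbT.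
have [||M1 [u1 d1 b1]] := h1 M hM _ s y _ hy hpos hneg.
- exact: closeW hMB.
- by rewrite s0 (le_trans se).
have [||M2 [u2 d2 b2]] := h2 M1 (usim_herm u1 hM) _ s (y p q) _ (hy _ _) (hpos _ _) (hneg _ _).
- apply: closeW (close_trans d1 hMB); apply: le_trans ee2.
  by rewrite mulrDr mulr1 addrC lerD2l mulrC ler_wpM2r.
- by rewrite s0 (le_trans _ ee2) // (le_trans se) // ler_peMr ?lerDl // (le_trans s0).
exists M2; split; first exact: usim_trans u2.
  by rewrite mulrDl addrC; exact: close_trans d1.
by move=> l; rewrite b2 b1 big_cons /=; ring.
Qed.

(** Running through all ordered pairs turns the individual transfers into the net inflow at each
    index. *)
Lemma flow : exists c e : R, [/\ 0 <= c, 0 < e &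
  forall M, M \is hermsymmx -> close M B e ->
  forall (s : R) (y : 'I_n -> 'I_n -> R), 0 <= s <= e ->
  (forall p q, `|y p q| <= s ^+ k) ->
  (forall p q, 0 < y p q -> reach p q) -> (forall p q, y p q < 0 -> reach q p) ->
  exists M', [/\ usim M M', close M' M (c * s) & forall l,
    bs M' l = bs M l + \sum_(p | lab p == l) \sum_q (y q p - y p q)]].
Proof.
have [c [e [c0 e0 h]]] := flow_seq (enum {: 'I_n * 'I_n}).
exists c, e; split=> // M hM hMB s y hs hy hpos hneg.
have [M' [u cl b]] := h M hM hMB s y hs hy hpos hneg.
exists M'; split => // l; rewrite b; congr (_ + _).
rewrite big_enum /= -(pair_bigA _ (fun p q => y p q * ((lab q == l)%:R - (lab p == l)%:R))) /=.
have sum_ind (f : 'I_n -> R) : \sum_p f p * (lab p == l)%:R = \sum_(p | lab p == l) f p.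
  by rewrite [RHS]big_mkcond; apply: eq_bigr => p _; case: ifP; rewrite ?mulr1 ?mulr0.
rewrite -sum_ind.
transitivity (\sum_p \sum_q y p q * (lab q == l)%:R - \sum_p \sum_q y p q * (lab p == l)%:R).
  rewrite -sumrB; apply: eq_bigr => p _; rewrite -sumrB; apply: eq_bigr => q _.
  by rewrite mulrBr.
rewrite exchange_big /= -sumrB; apply: eq_bigr => p _.
by rewrite -!mulr_suml -mulrBl sumrB.
Qed.

End Flow.

(** * Moving trace between blocks of eigenvalues *)

Section Transport.
Context {R : realType} {n : nat}.
Local Notation C := R[i].
Variables (a : 'I_n -> R) (lab : 'I_n -> 'I_n).

Lemma norm_realC (r : R) : `|r%:C%C : C| = `|r|%:C%C.
Proof. by rewrite normc_def /= expr0n addr0 sqrtr_sqr. Qed.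

Definition diagR (x : 'I_n -> R) : 'M[C]_n := diag_mx (\row_i (x i)%:C%C).

Lemma diagRE x i j : diagR x i j = if i == j then (x i)%:C%C else 0.
Proof. by rewrite !mxE; case: eqP => [->|_]; rewrite ?mulr1n ?mulr0n. Qed.

Lemma dg_diagR x i : dg (diagR x) i = x i.
Proof. by rewrite /dg diagRE eqxx. Qed.

Lemma diagR_herm x : diagR x \is hermsymmx.
Proof.
apply/hermP/matrixP => i j; rewrite adjE !diagRE eq_sym.
case: eqP => [->|_]; last by rewrite conjC0.
by apply/CrealP; rewrite complex_real.
Qed.

Hypothesis adjacent : forall p q : 'I_n, q = p.+1 :> nat -> reach 2 (diagR a) lab q p.

Lemma reach_down (p q : 'I_n) : (p <= q)%N -> reach 2 (diagR a) lab q p.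
Proof.
case: q => q hq /= pq.
elim: q hq pq => [|q IH] hq pq.
  by apply: reach_same; congr lab; apply: val_inj => /=; apply/eqP; rewrite eq_sym -leqn0.
move: pq; rewrite leq_eqVlt => /orP[/eqP pq|pq].
  by apply: reach_same; congr lab; exact: val_inj.
by apply: reach_trans (IH (ltnW hq) pq); exact: adjacent.
Qed.

(* The amount crossing from [m] to [m - 1] is the prefix sum at [m]. If it is
   negative, the prefix is not a union of blocks, and a block straddling [m]
   carries the flow upwards. *)
Lemma transport : exists c e : R, [/\ 0 <= c, 0 < e &
  forall (x : 'I_n -> R) (d : R), 0 <= d <= e -> (forall p, `|a p - x p| <= d) ->
  \sum_p (a p - x p) = 0 ->
  (forall m, (forall p q : 'I_n, (p < m <= q)%N -> lab p != lab q) ->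
     0 <= \sum_(p < n | (p < m)%N) (a p - x p)) ->
  exists N, [/\ usim (diagR x) N, close N (diagR a) (c * Num.sqrt d) &
    forall l, blocksum lab N l = blocksum lab (diagR a) l]].
Proof.
have [c [e [c0 e0 h]]] := flow 2 (diagR a) lab.
pose K : R := 1 + n%:R.
have K1 : 1 <= K by rewrite lerDl.
have K0 : 0 < K by apply: lt_le_trans K1.
(* For the three bounds: d <= 1 gives d <= sqrt d, d <= e puts [diagR x] in the range of [flow], and
   K d <= e^2 gives s <= e. *)
pose e' := Num.min 1 (Num.min e (e ^+ 2 / K)).
have e'0 : 0 < e' by rewrite !lt_min ltr01 e0 divr_gt0 // exprn_gt0.
exists (c * Num.sqrt K + 1), e'; split => //.
  by rewrite addr_ge0 ?mulr_ge0 ?sqrtr_ge0.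
move=> x d /andP[d0 de] hd htot hpre.
have d1 : d <= 1 by rewrite (le_trans de) // ge_min lexx.
have de1 : d <= e by rewrite (le_trans de) // !ge_min lexx !orbT.
have de2 : K * d <= e ^+ 2.
  by rewrite mulrC -ler_pdivlMr // (le_trans de) // !ge_min lexx !orbT.
pose X m := \sum_(p < n | (p < m)%N) (a p - x p).
have Xle m : `|X m| <= K * d.
  apply: le_trans (ler_norm_sum _ _ _) _.
  apply: le_trans (_ : \sum_(p < n) d <= _).
    rewrite big_mkcond; apply: ler_sum => p _.
    by case: ifP.
  by rewrite sumr_const card_ord -mulr_natl ler_wpM2r // lerDr.
pose y (p q : 'I_n) : R := if p == q.+1 :> nat then X p else 0.
pose s := Num.sqrt (K * d).
have s2 : s ^+ 2 = K * d by rewrite sqr_sqrtr // mulr_ge0 // ltW.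
have sE : s = Num.sqrt K * Num.sqrt d by rewrite /s sqrtrM // ltW.
have cl0 : close (diagR x) (diagR a) d.
  move=> i j; rewrite !diagRE; case: eqP => _.
    by rewrite -rmorphB norm_realC lecR distrC.
  by rewrite subrr normr0 lecR.
have [|||||N [u cl b]] := h (diagR x) (diagR_herm x) _ s y.
- exact: closeW cl0.
- rewrite sqrtr_ge0 -(ler_pXn2r (n:=2)) ?nnegrE ?sqrtr_ge0 ?(ltW e0) //.
  by rewrite s2.
- move=> p q; rewrite s2 /y; case: ifP => _ //.
  by rewrite normr0 mulr_ge0 // ltW.
- move=> p q; rewrite /y; case: eqP => [pq _|_]; last by rewrite ltxx.
  exact: adjacent.
- move=> p q; rewrite /y; case: eqP => [pq Xneg|_]; last by rewrite ltxx.
  have [hc|] := pselect (forall i j : 'I_n, (i < p <= j)%N -> lab i != lab j).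
    by have := hpre _ hc; rewrite -/(X p) leNgt Xneg.
  (* Route from [q], the position just below [p], up to [p]: down to [i], across the common block to
     [j], and down to [p]. *)
  move=> /existsNP[i /existsNP[j /not_implyP[/andP[ip pj] /negP]]].
  rewrite negbK => /eqP hij.
  apply: (reach_trans (q := i)); first by apply: reach_down; rewrite -ltnS -pq.
  apply: (reach_trans (q := j)); first exact: reach_same.
  exact: reach_down.
exists N; split => //.
  apply: closeW (close_trans cl cl0); rewrite sE mulrDl mul1r mulrA lerD2l.
  rewrite -{1}[d]sqr_sqrtr // expr2 ler_piMr ?sqrtr_ge0 //.
  by rewrite -[leRHS]sqrtr1 ler_wsqrtr.
(* The net inflow at [p] telescopes to X (p + 1) - X p = a p - x p. At the last position nothing
   comes from above, in agreement with X n = 0, which is [htot]. *)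
move=> l; rewrite b -big_split; apply: eq_bigr => p _; rewrite !dg_diagR /=.
rewrite sumrB.
have -> : \sum_q y q p = X p.+1.
  rewrite /y -big_mkcond /=.
  have [hp|hp] := ltnP p.+1 n.
    by rewrite (big_pred1 (Ordinal hp)).
  rewrite big1 => [|q /eqP hq]; last by have := ltn_ord q; rewrite hq ltnNge hp.
  rewrite /X (eq_bigl xpredT) ?htot // => q.
  by apply: leq_trans (ltn_ord q) hp.
have -> : \sum_q y p q = X p.
  rewrite /y -big_mkcond /=; case: (posnP p) => hp.
    rewrite big1 => [|q]; last by rewrite hp.
    by rewrite /X big1 // => q; rewrite hp ltn0.
  have hp' : (p.-1 < n)%N by rewrite prednK // ltnW.
  rewrite (big_pred1 (Ordinal hp')) // => q /=.
  by apply/eqP/eqP => [hq|->]; [apply: val_inj; rewrite /= hq|rewrite /= prednK].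
rewrite /X (bigD1 p) //= (eq_bigl (fun q : 'I_n => (q < p)%N)) => [|q].
  by ring.
by rewrite ltnS [RHS]ltn_neqAle andbC.
Qed.

End Transport.

(** * Eigenvectors adapted to the blocks, in increasing order *)

Section SortedIndices.
Context {n : nat}.

Lemma sorted_enumeration (leT : rel 'I_n) : total leT -> transitive leT ->
  exists2 f : 'I_n -> 'I_n, injective f & forall p q : 'I_n, (p <= q)%N -> leT (f p) (f q).
Proof.
move=> tot tr; pose s := sort leT (enum 'I_n).
have sz : size s = n by rewrite size_sort size_enum_ord.
exists (fun p => nth p s p).
  move=> p q; rewrite (set_nth_default q) ?sz ?ltn_ord // => /eqP.
  rewrite nth_uniq ?sz ?ltn_ord ?sort_uniq ?enum_uniq // => /eqP; exact: val_inj.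
move=> p q pq; rewrite (set_nth_default q) ?sz ?ltn_ord //.
have rfl : reflexive leT by move=> x; have := tot x x; rewrite orbb.
have hs : sorted leT s by exact: sort_sorted.
by apply: (sorted_leq_nth tr rfl q hs); rewrite ?inE ?sz ?ltn_ord.
Qed.

End SortedIndices.

Section BlockSpectral.
Context {R : realType} {n : nat}.
Local Notation C := R[i].
Variables (A : 'M[C]_n) (lab : 'I_n -> 'I_n).
Hypothesis hA : A \is hermsymmx.
Implicit Types (V : 'M[C]_n) (a : 'I_n -> R) (c : 'I_n -> 'I_n).

(** The conjugated rows of [V] form an orthonormal eigenbasis; the last condition says that each is
    supported in one block, which [c] records. *)
Definition block_eigen V a c :=
  [/\ V *m V^t* = 1%:M, A = V^t* *m diagR a *m V &
      forall p i, V p i != 0 -> c p = lab i].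

Lemma herm_trig_diag (X : 'M[C]_n) : X \is hermsymmx -> is_trig_mx X ->
  X = diagR (dg X).
Proof.
move=> hX /is_trig_mxP tX; apply/matrixP => i j; rewrite diagRE.
case: eqP => [->|/eqP ij]; first exact: dgE.
case: (ltngtP i j) => [lij|lji|/val_inj eij].
- exact: tX.
- by rewrite (hermE j i hX) tX // conjC0.
- by rewrite eij eqxx in ij.
Qed.

Hypothesis hlab : forall i j, A i j != 0 -> lab i = lab j.

(* Diagonalise [A] together with the diagonal matrix of the block labels. *)
Lemma block_eigen_ex : exists V a c, block_eigen V a c.
Proof.
pose D := diagR (fun i => (lab i)%:R : R).
have AD : A *m D = D *m A.
  apply/matrixP => i j; rewrite mul_mx_diag mul_diag_mx !mxE.
  have [->|/hlab ->] := eqVneq (A i j) 0; first by rewrite mulr0 mul0r.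
  exact: mulrC.
have [V hV /andP[]] := cotrigonalization2 AD.
rewrite /similar_to !conjymx // => tA tD.
have hVV : V *m V^t* = 1%:M by apply/unitarymxP.
have hVV' : V^t* *m V = 1%:M by apply: mulmx1C.
have us X : usim X (V *m X *m V^t*) by exists V.
have eA := herm_trig_diag (usim_herm (us A) hA) tA.
have eD := herm_trig_diag (usim_herm (us D) (diagR_herm _)) tD.
set a := dg _ in eA; set b := dg _ in eD.
have VD p i : V p i != 0 -> (lab i)%:R = b p.
  move=> hVpi.
  (* Compared entrywise, this forces the label of [i] to equal [b p] wherever [V p i] is nonzero: a
     row cannot meet two blocks. *)
  have : V *m D = diagR b *m V by rewrite -eD -[RHS]mulmxA hVV' mulmx1.
  move=> /matrixP /(_ p i); rewrite mul_mx_diag mul_diag_mx !mxE mulrC.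
  by move=> /(mulIf hVpi) [].
(* The default [p] concerns only a zero row, which a unitary matrix does not have. *)
pose c p := if [pick i | V p i != 0] is Some i then lab i else p.
exists V, a, c; split => //.
  by rewrite -eA !mulmxA hVV' mul1mx -mulmxA hVV' mulmx1.
move=> p i hpi; rewrite /c; case: pickP => [j hpj|/(_ i)]; last by rewrite hpi.
apply: val_inj; apply/eqP; rewrite -(eqr_nat R) /=.
by rewrite (VD _ _ hpi) (VD _ _ hpj).
Qed.

(** The block size times the difference between the mean eigenvalue of the block and [a p]:
    nonnegative if [a p] is least in its block, nonpositive if greatest, and in these cases zero
    only for a constant block. *)
Definition block_excess a c p : R := \sum_(r | c r == c p) (a r - a p).

(* Equal eigenvalues are ordered by the excess of their blocks; then [q] reaches
   every [p <= q] unless both blocks carry one and the same single eigenvalue. *)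
Definition ordered_blocks a c := forall p q : 'I_n, (p <= q)%N ->
  a p < a q \/ (a p = a q /\ block_excess a c p <= block_excess a c q).

Lemma ordered_block_eigen_ex :
  exists V a c, block_eigen V a c /\ ordered_blocks a c.
Proof.
have [V [a [c [hV eA hc]]]] := block_eigen_ex.
pose leT p q := (a p < a q) ||
  ((a p == a q) && (block_excess a c p <= block_excess a c q)).
have tot : total leT.
  move=> p q; rewrite /leT; case: (ltgtP (a p) (a q)) => //= _; exact: le_total.
have tr : transitive leT.
  move=> q p r; rewrite /leT => /orP[pq|/andP[/eqP pq hpq]] /orP[qr|/andP[/eqP qr hqr]].
  - by rewrite (lt_trans pq).
  - by rewrite -qr pq.
  - by rewrite pq qr.
  - by rewrite pq qr eqxx (le_trans hpq) ?orbT.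
have [f finj hf] := sorted_enumeration tot tr.
have fbij : bijective f := injF_bij finj.
exists (\matrix_(p, i) V (f p) i), (a \o f), (c \o f); split; first split.
- apply/matrixP => p q; rewrite !mxE.
  have /matrixP/(_ (f p) (f q)) := hV; rewrite !mxE (inj_eq finj) => <-.
  by apply: eq_bigr => i _; rewrite !mxE.
- apply/matrixP => i j; rewrite eA -!mulmxA !mul_diag_mx !mxE.
  rewrite (reindex f) /=; last exact: onW_bij.
  by apply: eq_bigr => p _; rewrite !mxE.
- by move=> p i; rewrite mxE; exact: hc.
move=> p q pq.
have ex p' : block_excess (a \o f) (c \o f) p' = block_excess a c (f p').
  by rewrite /block_excess [RHS](reindex f) //=; exact: onW_bij.
rewrite !ex /=; have := hf _ _ pq; rewrite /leT.
by move=> /orP[|/andP[/eqP -> ->]]; [left|right].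
Qed.

Variables (V : 'M[C]_n) (a : 'I_n -> R) (c : 'I_n -> 'I_n).
Hypothesis hVac : block_eigen V a c.

(** Conjugation by [V] sends the coordinate projection on the block [l] of [lab] to the one on the
    positions labelled [l] by [c], which is [inner]; the rest is cyclicity of the trace. *)
Lemma blocksum_conj N l : blocksum lab (V^t* *m N *m V) l = blocksum c N l.
Proof.
have [hV _ hc] := hVac.
have ReS (P : pred 'I_n) (F : 'I_n -> C) :
    \sum_(i | P i) complex.Re (F i) = complex.Re (\sum_(i | P i) F i).
  by apply/esym/big_morph => // -[? ?] [? ?].
rewrite /blocksum /dg !ReS; congr complex.Re.
have inner p q : \sum_(i | lab i == l) (V p i)^* * V q i
    = if (c p == l) && (p == q) then 1 else 0.
  have [cp|cp] := eqVneq (c p) l; last first.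
    apply: big1 => i /eqP li; have [->|/hc cpi] := eqVneq (V p i) 0.
      by rewrite conjC0 mul0r.
    by rewrite cpi li eqxx in cp.
  have /matrixP/(_ q p) := hV; rewrite !mxE /= eq_sym.
  have -> : (if p == q then 1 else 0) = (p == q)%:R :> C by case: eqP.
  move=> <-; rewrite big_mkcond; apply: eq_bigr => i _; rewrite adjE mulrC.
  case: ifP => // /negbT li; have [->|/hc cpi] := eqVneq (V p i) 0.
    by rewrite conjC0 mulr0.
  by rewrite -cpi cp eqxx in li.
transitivity (\sum_p \sum_q N p q * \sum_(i | lab i == l) (V p i)^* * V q i).
  under [RHS]eq_bigr => p _.
    under eq_bigr => q _ do rewrite mulr_sumr.
    rewrite exchange_big /=.
    over.
  rewrite exchange_big /=; apply: eq_bigr => i _; rewrite -mulmxA mxE.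
  apply: eq_bigr => p _; rewrite adjE mxE mulr_sumr; apply: eq_bigr => q _; ring.
rewrite [RHS]big_mkcond; apply: eq_bigr => p _.
under eq_bigr => q _ do rewrite inner.
case: ifP => cp /=; last by apply: big1 => q _; rewrite mulr0.
rewrite (bigD1 p) //= eqxx mulr1 big1 ?addr0 // => q.
by rewrite eq_sym => /negbTE ->; rewrite mulr0.
Qed.

(** The case N = [diagR a] of [blocksum_conj], summed over the labels in [S]. *)
Lemma sum_labels (S : pred 'I_n) :
  \sum_(p | S (c p)) a p = \sum_(i | S (lab i)) dg A i.
Proof.
have [_ eA _] := hVac.
rewrite (partition_big c S) // [RHS](partition_big lab S) //.
apply: eq_bigr => l Sl; have := blocksum_conj (diagR a) l.
rewrite -eA /blocksum => h.
rewrite (eq_bigl (fun p => c p == l)) => [|p]; last by rewrite andb_idl // => /eqP ->.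
rewrite [RHS](eq_bigl (fun i => lab i == l)) => [|p]; last by rewrite andb_idl // => /eqP ->.
by rewrite h; apply: eq_bigr => p _; rewrite dg_diagR.
Qed.

(** The case N = 1 of [blocksum_conj]: a block has as many eigenvalues as indices. *)
Lemma card_labels (S : pred 'I_n) :
  #|[pred p | S (c p)]| = #|[pred i | S (lab i)]|.
Proof.
have [hV _ _] := hVac.
suff h : \sum_(p | S (c p)) (1 : R) = \sum_(i | S (lab i)) 1.
  by apply/eqP; rewrite -(eqr_nat R) -!sumr_const; apply/eqP.
rewrite (partition_big c S) // [RHS](partition_big lab S) //.
apply: eq_bigr => l Sl; have := blocksum_conj 1%:M l.
rewrite mulmx1 (mulmx1C hV) /blocksum => h.
rewrite (eq_bigl (fun p => c p == l)) => [|p]; last by rewrite andb_idl // => /eqP ->.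
rewrite [RHS](eq_bigl (fun i => lab i == l)) => [|p]; last by rewrite andb_idl // => /eqP ->.
have d1 i : dg 1%:M i = 1 :> R by rewrite /dg mxE eqxx.
rewrite (eq_bigr (fun p => dg 1%:M p)) => [|p _]; last by rewrite d1.
by rewrite -h; apply: eq_bigr => p _; rewrite d1.
Qed.

(** For [i] in the support of row [p], only the [r] in the block of [p] contribute to row [i] of V^*
    diag(a) V; the common value [a p] factors out and V^* V = 1 remains. *)
Lemma const_block p : (forall r, c r = c p -> a r = a p) ->
  exists2 i, lab i = c p & forall j, A i j = if i == j then (a p)%:C%C else 0.
Proof.
have [hV eA hc] := hVac => hp.
have [i hi] : exists i, V p i != 0.
  apply/existsP; apply: contraT; rewrite negb_exists => /forallP h0.
  have /matrixP/(_ p p) := hV; rewrite !mxE eqxx big1 => [/eqP|i _].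
    by rewrite eq_sym oner_eq0.
  by have := h0 i; rewrite negbK => /eqP ->; rewrite mul0r.
exists i; first by rewrite (hc _ _ hi).
move=> j; rewrite eA -mulmxA mul_diag_mx mxE.
have /matrixP/(_ i j) := mulmx1C hV; rewrite !mxE => h.
have -> : (if i == j then (a p)%:C%C else 0) = (a p)%:C%C * (i == j)%:R :> C.
  by case: (i == j); rewrite ?mulr1 ?mulr0.
rewrite -h mulr_sumr; apply: eq_bigr => r _; rewrite !adjE !mxE.
have [->|hri] := eqVneq (V r i) 0; first by rewrite conjC0; ring.
by rewrite (hp r) ?(hc _ _ hri) ?(hc _ _ hi) //; ring.
Qed.

Hypothesis hord : ordered_blocks a c.
Hypothesis hconst : forall p q, (forall r, c r = c p -> a r = a p) ->
  (forall r, c r = c q -> a r = a q) -> a p = a q -> c p = c q.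

(** For equal eigenvalues, a smaller one in the block of [p] or a larger one in the block of [q]
    provides a gap. Otherwise the excesses are nonnegative at [p] and nonpositive at [q]; the
    ordering makes both vanish, so both blocks are constant with the same value, hence equal by
    [hconst]. *)
Lemma ordered_reach (p q : 'I_n) : (p <= q)%N -> reach 2 (diagR a) c q p.
Proof.
move=> pq; have gap r r' : a r < a r' -> reach 2 (diagR a) c r' r.
  by move=> h; apply: reach_gap; rewrite ?diagR_herm // !dg_diagR.
have [/gap//|[eqa exc]] := hord pq.
have [[r cr ar]|hp] := pselect (exists2 r, c r = c p & a r < a p).
  by apply: (reach_trans (q := r)); [apply: gap; rewrite -eqa|exact: reach_same].
have [[r cr ar]|hq] := pselect (exists2 r, c r = c q & a q < a r).
  by apply: (reach_trans (q := r)); [exact: reach_same|apply: gap; rewrite eqa].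
have hp' r : c r == c p -> 0 <= a r - a p.
  move=> /eqP cr; rewrite subr_ge0 leNgt; apply/negP => ar; apply: hp; by exists r.
have hq' r : c r == c q -> 0 <= a q - a r.
  move=> /eqP cr; rewrite subr_ge0 leNgt; apply/negP => ar; apply: hq; by exists r.
have exp : 0 <= block_excess a c p by exact: sumr_ge0.
have exq : 0 <= - block_excess a c q.
  by rewrite -sumrN; apply: sumr_ge0 => r /hq'; rewrite opprB.
have exp0 : block_excess a c p = 0 by lra.
have exq0 : - block_excess a c q = 0 by lra.
apply: reach_same; apply/esym; apply: hconst => // r /eqP cr.
  by apply/eqP; rewrite -subr_eq0; move: exp0 => /psumr_eq0P -> //.
apply/esym/eqP; rewrite -subr_eq0.
move: exq0; rewrite -sumrN.
rewrite (eq_bigr (fun r => a q - a r)) => [|? _]; last by rewrite opprB.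
by move=> /psumr_eq0P -> //.
Qed.

End BlockSpectral.

(** * Sorted vectors and lists of eigenvalues *)

Section SortUp.
Context {R : realType} {n : nat}.
Implicit Types (x y : 'rV[R]_n).

Lemma size_sort_up x : size (sort_up x) = n.
Proof. by rewrite size_sort size_map size_enum_ord. Qed.

Lemma perm_sort_up x : perm_eq (sort_up x) [seq x 0 i | i <- enum 'I_n].
Proof. by rewrite perm_sort. Qed.

Lemma sort_up_le x (i j : nat) : (i <= j < n)%N -> (sort_up x)`_i <= (sort_up x)`_j.
Proof.
move=> /andP[ij jn].
have hs : sorted <=%R (sort_up x) by apply: sort_sorted; exact: le_total.
apply: (sorted_leq_nth le_trans lexx 0 hs) => //; rewrite inE size_sort_up //.
exact: leq_ltn_trans jn.
Qed.

Lemma big_sort_up x (F : R -> R) :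
  \sum_(i < n) F (sort_up x)`_i = \sum_i F (x 0 i).
Proof.
transitivity (\sum_(r <- sort_up x) F r); first by rewrite (big_nth 0) size_sort_up big_mkord.
by rewrite (perm_big _ (perm_sort_up x)) /= big_map big_enum.
Qed.

(** Let v be the entry of rank m = #|X|, at index m - 1. The sum of all min (x_i - v, 0) equals that
    of x_i - v over the m smallest entries, and is at most that over any [X]. *)
Lemma sum_sort_up_prefix x (X : pred 'I_n) :
  \sum_(i < #|X|) (sort_up x)`_i <= \sum_(i | X i) x 0 i.
Proof.
have hX : (#|X| <= n)%N by rewrite -[leqRHS]card_ord max_card.
set m := #|X| in hX *; have [m0|mpos] := posnP m.
  rewrite m0 big_ord0 big_pred0 // => i.
  by apply: negbTE; move/eqP: m0; rewrite /m => /pred0P /(_ i) /= ->.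
pose v := (sort_up x)`_m.-1.
have h1 : \sum_(i < m) ((sort_up x)`_i - v) = \sum_i Num.min (x 0 i - v) 0.
  rewrite -(big_sort_up x (fun r => Num.min (r - v) 0)).
  rewrite (big_ord_widen _ (fun i => (sort_up x)`_i - v) hX) big_mkcond.
  apply: eq_bigr => i _; case: ltnP => im.
    rewrite min_l // subr_le0 sort_up_le // -ltnS prednK // im /=.
    by rewrite ?andbT (leq_trans _ hX) // prednK.
  rewrite min_r // subr_ge0 sort_up_le // ltn_ord andbT.
  by rewrite (leq_trans (leq_pred _)).
have h2 : \sum_i Num.min (x 0 i - v) 0 <= \sum_(i | X i) (x 0 i - v).
  rewrite [leRHS]big_mkcond; apply: ler_sum => i _.
  by case: ifP => _; rewrite ge_min lexx ?orbT.
have := h2; rewrite -h1 !sumrB !sumr_const card_ord.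
by rewrite -/m lerD2r.
Qed.

(** Counting: at least p + 1 entries of [x] are at most its sorted value at p. If the bound failed,
    the same p + 1 positions of [y] would lie strictly below the sorted value of [y] at p, where at
    most p entries fit. *)
Lemma sort_up_lip x y (d : R) : (forall i, `|x 0 i - y 0 i| <= d) ->
  forall p, (p < n)%N -> (sort_up y)`_p <= (sort_up x)`_p + d.
Proof.
move=> h p pn; rewrite leNgt; apply/negP => hlt.
have cnt (z : 'rV[R]_n) (P : pred R) : count P (sort_up z) = #|[pred i | P (z 0 i)]|.
  rewrite (seq.permP (perm_sort_up z)) count_map -size_filter cardE.
  by rewrite /enum_mem -filter_predI; congr size; apply: eq_filter => i; rewrite !inE andbT.
pose P (r : R) := r <= (sort_up x)`_p; pose Q (r : R) := r < (sort_up y)`_p.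
have c1 : (p < count P (sort_up x))%N.
  rewrite -(cat_take_drop p.+1 (sort_up x)) count_cat.
  have -> : count P (take p.+1 (sort_up x)) = p.+1.
    rewrite -[RHS](@size_takel p.+1 _ (sort_up x)) ?size_sort_up //.
    apply/eqP; rewrite -all_count; apply/(all_nthP 0) => i.
    rewrite size_takel ?size_sort_up // => ip; rewrite nth_take //.
    by apply: sort_up_le; rewrite -ltnS ip.
  by rewrite leq_addr.
have c2 : (count Q (sort_up y) <= p)%N.
  rewrite -(cat_take_drop p (sort_up y)) count_cat.
  have -> : count Q (drop p (sort_up y)) = 0%N.
    apply/eqP; rewrite -leqn0 leqNgt -has_count -all_predC.
    apply/(all_nthP 0) => i; rewrite size_drop size_sort_up nth_drop => hi.
    by rewrite /= /Q -leNgt; apply: sort_up_le; rewrite leq_addr /= -ltn_subRL.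
  by rewrite addn0 (leq_trans (count_size _ _)) // size_take size_sort_up pn.
rewrite !cnt in c1 c2.
suff sub : (#|[pred i : 'I_n | P (x ord0 i)]|
        <= #|[pred i : 'I_n | Q (y ord0 i)]|)%N.
  by have := leq_trans c1 (leq_trans sub c2); rewrite ltnn.
apply: subset_leq_card; apply/fintype.subsetP => i; rewrite !inE /P /Q => hi.
have := h i; rewrite ler_norml => /andP[h1 h2].
by apply: le_lt_trans hlt; lra.
Qed.

Lemma sort_up_unique x (a : 'I_n -> R) :
  (forall p q : 'I_n, (p <= q)%N -> a p <= a q) ->
  perm_eq [seq a p | p <- enum 'I_n] [seq x 0 i | i <- enum 'I_n] ->
  forall p : 'I_n, a p = (sort_up x)`_p.
Proof.
move=> mono hp p.
have sz : size [seq a p | p <- enum 'I_n] = n by rewrite size_map size_enum_ord.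
have nthE i (hi : (i < n)%N) : [seq a p | p <- enum 'I_n]`_i = a (Ordinal hi).
  rewrite (nth_map (Ordinal hi)) ?size_enum_ord //; congr a.
  by apply: val_inj; rewrite /= nth_enum_ord.
suff <- : [seq a p | p <- enum 'I_n] = sort_up x.
  by rewrite (nthE p (ltn_ord p)); congr a; exact: val_inj.
apply: (sorted_eq le_trans le_anti).
- apply/(sortedP 0) => i; rewrite sz => hi.
  by rewrite (nthE _ hi) (nthE _ (ltnW hi)) mono /=.
- by apply: sort_sorted; exact: le_total.
- by apply: perm_trans hp _; rewrite perm_sym perm_sort_up.
Qed.

Lemma char_poly_diagR (a : 'I_n -> R) :
  char_poly (diagR a) = \prod_(i < n) ('X - ((a i)%:C%C)%:P).
Proof.
rewrite char_poly_trig ?diag_mx_is_trig //.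
by apply: eq_bigr => i _; rewrite diagRE eqxx.
Qed.

Lemma eigenvalues_perm (a : 'I_n -> R) x :
  has_eigenvalues (diagR a) x ->
  perm_eq [seq a p | p <- enum 'I_n] [seq x 0 i | i <- enum 'I_n].
Proof.
rewrite /has_eigenvalues char_poly_diagR => h.
have rC_inj : injective (fun r : R => r%:C%C) by move=> r s [].
apply: (perm_map_inj rC_inj); apply: prod_XsubC_eq.
by rewrite [LHS]big_map [LHS]big_map [RHS]big_map [RHS]big_map !big_enum.
Qed.

Lemma eigenvalues_sort_up x : has_eigenvalues (diagR (fun p => (sort_up x)`_p)) x.
Proof.
rewrite /has_eigenvalues char_poly_diagR.
transitivity (\prod_(r <- sort_up x) ('X - (r%:C%C)%:P) : {poly R[i]}).
  by rewrite (big_nth 0) size_sort_up big_mkord.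
by rewrite (perm_big _ (perm_sort_up x)) /= big_map big_enum.
Qed.

End SortUp.

(** * Restoring the diagonal inside the blocks *)

Section Components.
Context {R : realType} {n : nat}.
Local Notation C := R[i].
Variable A : 'M[C]_n.
Hypothesis hA : A \is hermsymmx.

Definition isolated i := [forall j, (j != i) ==> (A i j == 0)].

(* Isolated indices with the same diagonal entry are linked: on them [A] is
   scalar, so no move between them is available near [A], but every rotation
   among them commutes with [A]. *)
Definition link i j :=
  (A i j != 0) || [&& isolated i, isolated j & dg A i == dg A j].

(** The label of a class is one of its own indices, which [fix_connected] uses as a hub. *)
Definition component i := fingraph.root link i.

Lemma link_sym : symmetric link.
Proof.
move=> i j; rewrite /link (hermE j i hA) conjC_eq0 [dg A i == _]eq_sym.
by rewrite andbCA.
Qed.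

Lemma link_connect_sym : connect_sym link.
Proof. exact: sym_connect_sym link_sym. Qed.

Lemma componentP i j : reflect (component i = component j) (connect link i j).
Proof. rewrite -(root_connect link_connect_sym); exact: eqP. Qed.

Lemma componentK i : component (component i) = component i.
Proof. exact: root_root link_connect_sym i. Qed.

Lemma component_entry i j : A i j != 0 -> component i = component j.
Proof. by move=> h; apply/componentP/connect1; rewrite /link h. Qed.

Lemma isolated0 i j : isolated i -> j != i -> A i j = 0.
Proof. by move=> /forallP/(_ j)/implyP h /h /eqP. Qed.

Lemma isolated0r i j : isolated i -> j != i -> A j i = 0.
Proof. by move=> hi hj; rewrite (hermE i j hA) isolated0 // conjC0. Qed.

(** A nonzero entry links an isolated index only to itself, so a path from it uses only links of the
    second kind. *)
Lemma connect_isolated i j : connect link i j -> isolated i ->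
  isolated j /\ dg A j = dg A i.
Proof.
move=> /connectP[s]; elim: s i => [|k s IH] i /=; first by move=> _ ->.
move=> /andP[ik ps] jl hi; have [hk dk] : isolated k /\ dg A k = dg A i.
  move: ik; rewrite /link => /orP[ik|/and3P[_ -> /eqP ->]] //.
  suff -> : k = i by [].
  by apply: contraNeq ik => ki; rewrite isolated0.
by rewrite -dk; exact: IH.
Qed.

(** In the class of a non-isolated index all links are nonzero entries, so [reach_edge] chains along
    the path. The labelling [id] makes block sums single diagonal entries. *)
Lemma connect_reach i j : connect link i j -> ~~ isolated i -> reach 1 A id i j.
Proof.
move=> /connectP[s]; elim: s i => [|k s IH] i /=.
  by move=> _ -> _; exact: reach_same.
move=> /andP[ik ps] jl hi.
have hk : ~~ isolated k.
  apply: contra hi => hk.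
  have ki : connect link k i by rewrite link_connect_sym connect1.
  by have [] := connect_isolated ki hk.
apply: (reach_trans (q := k)); last exact: IH.
move: ik; rewrite /link (negbTE hi) orbF => ik.
have [->|nik] := eqVneq i k; first exact: reach_same.
exact: reach_edge.
Qed.

(** With the cross term killed, the new entry at [i] is the average of M_ii and M_jj with weights 1
    and s = |w|^2; since A_ii lies strictly between them, some s > 0 hits it exactly. *)
Lemma isolated_rotation M i j : M \is hermsymmx ->
  isolated i -> isolated j -> i != j -> dg A i = dg A j ->
  dg M i < dg A i < dg M j ->
  exists U, [/\ U *m U^t* = 1%:M, U *m A *m U^t* = A &
    let M' := U *m M *m U^t* in
    [/\ dg M' i = dg A i, dg M' i + dg M' j = dg M i + dg M j &
        forall k, k != i -> k != j -> dg M' k = dg M k]].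
Proof.
move=> hM hi hj ij dij /andP[hlt hgt].
pose s := (dg A i - dg M i) / (dg M j - dg A i).
have s0 : 0 < s by rewrite divr_gt0 // subr_gt0.
have [u hu1 hu] := phase (M j i).
pose w := 'i%C * (Num.sqrt s)%:C%C * u.
have hw : sqnorm w = s.
  rewrite !sqnormM hu1 sqnorm_real sqr_sqrtr ?(ltW s0) //.
  by rewrite /sqnorm /= expr0n expr1n add0r mul1r mulr1.
have hRe : complex.Re (w * M j i) = 0.
  by rewrite /w -!mulrA hu /=; ring.
exists (rot i j w); split; first exact: rot_unitary.
  apply: rot_fix => //.
  - by rewrite !dgE // dij.
  - by rewrite isolated0 // eq_sym.
  - by rewrite isolated0.
  - by move=> k ki kj; split; [exact: isolated0|exact: isolated0|exact: isolated0r|exact: isolated0r].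
split.
- rewrite dg_rot // hw hRe; apply: (canLR (mulfK _)).
    by rewrite gt_eqF // addr_gt0.
  have : s * (dg M j - dg A i) = dg A i - dg M i.
    by rewrite divfK // gt_eqF // subr_gt0.
  by lra.
- exact: dg_rot_sum.
- by move=> k; exact: dg_rot_other.
Qed.

Lemma blocksum_dgB (M N : 'M[C]_n) l :
  blocksum component M l = blocksum component N l ->
  \sum_(i | component i == l) (dg M i - dg N i) = 0.
Proof. by rewrite sumrB /blocksum => ->; rewrite subrr. Qed.

Lemma isolated_unbalanced M i : isolated i ->
  (forall l, blocksum component M l = blocksum component A l) ->
  dg M i != dg A i ->
  exists j k, [/\ isolated j, isolated k, component j = component k,
    dg A j = dg A k & dg M j < dg A j < dg M k].
Proof.
move=> hi hbs ne; have h0 := blocksum_dgB (hbs (component i)).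
have cls j : component j == component i -> isolated j /\ dg A j = dg A i.
  by move=> /eqP/esym/componentP/connect_isolated; apply.
(* The errors in the class sum to zero, so one sign forces the other somewhere; [sg] treats excess
   and deficit together. *)
have opp (sg : R) : sg ^+ 2 = 1 -> 0 < sg * (dg M i - dg A i) ->
    exists2 j, component j == component i & sg * (dg M j - dg A j) < 0.
  move=> hsg hpos; apply: contrapT => hno.
  have nn j : component j == component i -> 0 <= sg * (dg M j - dg A j).
    by move=> hj; rewrite leNgt; apply/negP => ?; apply: hno; exists j.
  have := h0; move=> /(congr1 (fun x => sg * x)); rewrite mulr0 mulr_sumr.
  move=> /(psumr_eq0P nn) /(_ i (eqxx _)) h; by rewrite h ltxx in hpos.
have [lt|gt] : dg M i < dg A i \/ dg A i < dg M i.
  by move: ne; rewrite neq_lt => /orP.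
- have [||k hk hk'] := opp (-1); [by rewrite sqrrN expr1n|by lra|].
  have [ik dk] := cls _ hk; exists i, k; rewrite dk; split => //.
    by rewrite (eqP hk).
  by rewrite lt /=; lra.
have [||k hk hk'] := opp 1; [by rewrite expr1n|by lra|].
have [ik dk] := cls _ hk; exists k, i; rewrite dk; split => //.
  exact/eqP.
by rewrite gt andbT; lra.
Qed.

(* The rotations used fix [A], hence cost only a constant factor on the distance
   to [A] although their angles need not be small. *)
Lemma fix_isolated_aux m M (e : R) : 0 <= e -> M \is hermsymmx ->
  (forall l, blocksum component M l = blocksum component A l) ->
  close M A e -> (#|[pred i | isolated i && (dg M i != dg A i)]| <= m)%N ->
  exists M', [/\ usim M M', close M' A ((n%:R ^+ 2 + 1) ^+ m * e),
    forall l, blocksum component M' l = blocksum component A l &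
    forall i, isolated i -> dg M' i = dg A i].
Proof.
elim: m M e => [|m IH] M e e0 hM hbs hMA.
  rewrite leqn0 => /eqP/card0_eq h0; exists M; split=> //.
  - exact: usim_refl.
  - by rewrite expr0 mul1r.
  by move=> i hi; have := h0 i; rewrite !inE hi /= => /negbFE /eqP.
have K1 : 1 <= n%:R ^+ 2 + 1 :> R by rewrite lerDr sqr_ge0.
case: (pickP [pred i | isolated i && (dg M i != dg A i)]) => [i /= /andP[hi ne]|h0] hcard.
  have [j [k [hj hk cjk djk hlt]]] := isolated_unbalanced hi hbs ne.
  have jk : j != k.
    by apply: contraTneq hlt => ->; apply/negP => /andP[/lt_trans h /h]; rewrite ltxx.
  have [U [hU hUA [dj dsum dother]]] := isolated_rotation hM hj hk jk djk hlt.
  set M1 := U *m M *m U^t* in dj dsum dother.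
  have u1 : usim M M1 by exists U.
  have e1 : 0 <= n%:R ^+ 2 * e by rewrite mulr_ge0 ?sqr_ge0.
  have bs1 l : blocksum component M1 l = blocksum component A l.
    rewrite -hbs /blocksum; have [cl|cl] := eqVneq (component j) l.
      have kl : (component k == l) && (k != j) by rewrite -cjk cl eq_sym jk eqxx.
      rewrite (bigD1 j) ?cl //= (bigD1 k kl) /=.
      rewrite [RHS](bigD1 j) ?cl //= [X in _ = _ + X](bigD1 k kl) /=.
      rewrite !addrA dsum; congr (_ + _); apply: eq_bigr => x.
      by move=> /andP[/andP[_ xj] xk]; rewrite dother.
    apply: eq_bigr => x /eqP cx; rewrite dother //.
      by apply: contra cl => /eqP <-; rewrite cx.
    by apply: contra cl => /eqP xk; rewrite cjk -xk cx.
  have cl1 : close M1 A (n%:R ^+ 2 * e).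
    by rewrite -{1}hUA; exact: close_conj.
  have [|M' [u' cl' bs' d']] := IH M1 _ e1 (usim_herm u1 hM) bs1 cl1.
    (* The set of wrong isolated indices loses [j] and gains nothing: [k] already belonged to it. *)
    rewrite -ltnS; apply: leq_trans hcard; apply: proper_card.
    apply/properP; split.
      apply/fintype.subsetP => x; rewrite !inE => /andP[hx].
      have [->|xj] := eqVneq x j; first by rewrite dj eqxx.
      have [xk _|xk] := eqVneq x k; last by rewrite hx dother.
      rewrite xk hk /= -djk gt_eqF //; by case/andP: hlt.
    exists j; rewrite !inE hj /= ?dj ?eqxx // lt_eqF //; by case/andP: hlt.
  exists M'; split => //; first exact: usim_trans u'.
  apply: closeW cl'; rewrite [_ ^+ m.+1]exprSr -[leRHS]mulrA.
  rewrite ler_wpM2l ?exprn_ge0 ?addr_ge0 ?sqr_ge0 //.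
  by rewrite ler_wpM2r // lerDl.
exists M; split => //; first exact: usim_refl.
  by apply: closeW hMA; rewrite ler_peMl // exprn_ege1.
by move=> x hx; have := h0 x; rewrite /= hx /= => /negbFE/eqP.
Qed.

Lemma fix_isolated M (e : R) : 0 <= e -> M \is hermsymmx ->
  (forall l, blocksum component M l = blocksum component A l) ->
  close M A e ->
  exists M', [/\ usim M M', close M' A ((n%:R ^+ 2 + 1) ^+ n * e),
    forall l, blocksum component M' l = blocksum component A l &
    forall i, isolated i -> dg M' i = dg A i].
Proof.
move=> e0 hM hbs hMA; apply: (@fix_isolated_aux n M e) => //.
by rewrite -[leqRHS]card_ord max_card.
Qed.

(** A star-shaped flow: the root of each class sends every other index its missing amount. Isolated
    indices have nothing to receive, so only first-order moves occur and the cost is linear in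
    [s]. *)
Lemma fix_connected : exists c e : R, [/\ 0 <= c, 0 < e &
  forall M, M \is hermsymmx ->
  (forall l, blocksum component M l = blocksum component A l) ->
  (forall i, isolated i -> dg M i = dg A i) ->
  forall s, 0 <= s <= e -> close M A s ->
  exists M', [/\ usim M M', close M' M (c * s) & forall i, dg M' i = dg A i]].
Proof.
have [c [e [c0 e0 h]]] := flow 1 A (@id 'I_n).
exists c, e; split=> // M hM hbs hiso s /andP[s0 se] hMA.
pose x q := dg A q - dg M q.
pose y p q := if (p == component q) && (q != p) then x q else 0.
have xle q : `|x q| <= s by rewrite distrC; exact: close_dg.
have reach_comp q : x q != 0 -> reach 1 A id q (component q) /\ reach 1 A id (component q) q.
  move=> xq; have nq : ~~ isolated q.
    by apply: contra xq => /hiso; rewrite /x => ->; rewrite subrr.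
  have cq : connect link q (component q) by apply/componentP; rewrite componentK.
  split; first exact: connect_reach.
  have cq' : connect link (component q) q by rewrite link_connect_sym.
  apply: connect_reach => //; apply: contra nq => hc.
  by have [] := connect_isolated cq' hc.
have [|||||M' [u cl b]] := h M hM _ s y.
- exact: closeW hMA.
- by rewrite s0.
- move=> p q; rewrite expr1 /y; case: ifP => _ //.
  by rewrite normr0.
- move=> p q; rewrite /y; case: ifP => [/andP[/eqP -> _] hx|_]; last by rewrite ltxx.
  by have [] := reach_comp q; rewrite ?gt_eqF.
- move=> p q; rewrite /y; case: ifP => [/andP[/eqP -> _] hx|_]; last by rewrite ltxx.
  by have [] := reach_comp q; rewrite ?lt_eqF.
exists M'; split => // p; have := b p.
have idE N : blocksum id N p = dg N p by rewrite /blocksum (big_pred1_eq _ p).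
have idS (F : 'I_n -> R) : \sum_(i | id i == p) F i = F p by rewrite (big_pred1_eq _ p).
rewrite !idE idS => ->; rewrite sumrB.
have -> : \sum_q y q p = if component p == p then 0 else x p.
  rewrite (bigD1 (component p)) //= big1 => [|q]; last first.
    by rewrite /y => /negbTE ->.
  by rewrite addr0 /y eqxx /= eq_sym; case: eqP.
have [cp|cp] := eqVneq (component p) p.
  (* At a root, what was sent out is exactly its own surplus because the class already has the right
     trace. *)
  have := blocksum_dgB (hbs p); rewrite (bigD1 p) ?cp //= => hs.
  have -> : \sum_q y p q = \sum_(q | (component q == p) && (q != p)) x q.
    rewrite [RHS]big_mkcond; apply: eq_bigr => q _.
    by rewrite /y eq_sym.
  have -> : \sum_(q | (component q == p) && (q != p)) x q =
            - \sum_(q | (component q == p) && (q != p)) (dg M q - dg A q).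
    by rewrite -sumrN; apply: eq_bigr => q _; rewrite opprB.
  by move: hs; set S := \sum_(_ | _) _ => hs; lra.
rewrite big1 => [|q _]; first by rewrite /x; ring.
rewrite /y; case: ifP => // /andP[/eqP pq _].
by rewrite pq componentK eqxx in cp.
Qed.

End Components.

(** * Assembly with uniform constants *)

Section Uniform.
Context {R : realType} {n : nat}.
Local Notation C := R[i].
Implicit Types (A M : 'M[C]_n) (lambda d : 'rV[R]_n).

Lemma sum_prefix_ord m (F : nat -> R) : (m <= n)%N ->
  \sum_(p < n | (p < m)%N) F p = \sum_(i < m) F i.
Proof. by move=> mn; rewrite (big_ord_widen _ F mn). Qed.

(** If the first m eigenvalues fill whole blocks, their sum is that of m diagonal entries, hence at
    least the sum of the m smallest entries of [d], which majorization compares with [lambdat]. *)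
Lemma prefix_excess_ge0 A (lab c : 'I_n -> 'I_n) V a lambdat d :
  block_eigen A lab V a c -> has_diagonal A d -> majorized_by lambdat d ->
  \sum_p (a p - (sort_up lambdat)`_p) = 0 /\
  forall m, (forall p q : 'I_n, (p < m <= q)%N -> c p != c q) ->
    0 <= \sum_(p < n | (p < m)%N) (a p - (sort_up lambdat)`_p).
Proof.
move=> hV hd [hmaj htot].
have dgd i : dg A i = d 0 i by rewrite /dg hd.
have tot : \sum_p (a p - (sort_up lambdat)`_p) = 0.
  rewrite sumrB htot (big_sort_up d id) (sum_labels hV predT) /=.
  by rewrite (eq_bigr _ (fun i _ => dgd i)) subrr.
split => // m hm; have [nm|mn] := leqP n m.
  by rewrite (eq_bigl xpredT) ?tot // => p; exact: leq_trans (ltn_ord p) nm.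
have [->|mpos] := posnP m; first by rewrite big_pred0.
pose S l := [exists p : 'I_n, (p < m)%N && (c p == l)].
have ScE p : S (c p) = (p < m)%N.
  apply/existsP/idP => [[q /andP[qm /eqP cq]]|pm]; last by exists p; rewrite pm eqxx.
  by rewrite ltnNge; apply/negP => mp; have := hm q p; rewrite qm mp cq eqxx => /(_ isT).
rewrite sumrB subr_ge0 (sum_prefix_ord (fun i => (sort_up lambdat)`_i)) ?(ltnW mn) //.
rewrite -(eq_bigl _ _ ScE) (sum_labels hV S) (eq_bigr _ (fun i _ => dgd i)).
apply: le_trans (hmaj m _) _.
  by rewrite mpos -ltnS prednK // (leq_trans mpos) // ltnW.
have cardS : #|[pred i | S (lab i)]| = m.
  rewrite -(card_labels hV S) (eq_card (B := [pred p : 'I_n | (p < m)%N])) => [|p].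
    rewrite -sum1_card -(big_ord_widen n (fun=> 1%N) (ltnW mn)).
    by rewrite sum_nat_const card_ord muln1.
  by rewrite !inE ScE.
by have := sum_sort_up_prefix d (fun i => S (lab i)); rewrite cardS.
Qed.

(** The statement for one perturbation of size [r], with constants chosen before it; families in
    epsilon are handled afterwards. *)
Lemma schur_horn_uniform A lambda d : A \is hermsymmx ->
  has_eigenvalues A lambda -> has_diagonal A d ->
  exists c e : R, [/\ 0 <= c, 0 < e & forall (lambdat : 'rV[R]_n) (r : R),
    0 <= r <= e -> (forall i, `|lambda 0 i - lambdat 0 i| <= r) ->
    majorized_by lambdat d ->
    exists M, [/\ M \is hermsymmx, has_eigenvalues M lambdat, has_diagonal M d &
      close A M (c * Num.sqrt r)]].
Proof.
move=> hA hev hdiag.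
have [V [a [c [hV hord]]]] := ordered_block_eigen_ex hA (component_entry hA).
have [hVV eA hc] := hV.
have hVV' : V^t* *m V = 1%:M by apply: mulmx1C.
(* A block with a single eigenvalue contains an isolated index, and isolated indices with equal
   entries are linked. *)
have hconst p q : (forall r, c r = c p -> a r = a p) ->
    (forall r, c r = c q -> a r = a q) -> a p = a q -> c p = c q.
  move=> /(const_block hV)[i <- Ai] /(const_block hV)[j <- Aj] apq.
  apply/componentP/connect1 => //; rewrite /link.
  have iso k x : (forall l, A k l = if k == l then x else 0) -> isolated A k.
    move=> h; apply/forallP => l; apply/implyP => lk.
    by rewrite h (eq_sym k) (negbTE lk).
  have dgi : dg A i = a p by rewrite /dg Ai eqxx.
  have dgj : dg A j = a q by rewrite /dg Aj eqxx.
  by rewrite (iso _ _ Ai) (iso _ _ Aj) dgi dgj apq eqxx orbT.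
have adj (p q : 'I_n) : q = p.+1 :> nat -> reach 2 (diagR a) c q p.
  by move=> pq; apply: ordered_reach => //; rewrite pq.
have [c1 [e1 [c10 e10 h1]]] := transport adj.
have [c2 [e2 [c20 e20 h2]]] := fix_connected hA.
have aE : forall p : 'I_n, a p = (sort_up lambda)`_p.
  apply: sort_up_unique => [p q /hord [/ltW//|[-> //]]|].
  apply: eigenvalues_perm; rewrite /has_eigenvalues -hev.
  by apply/esym/usim_char_poly; exists (V^t*); rewrite ?trmxCK.
(* The cost [c1] of [transport], times n^2 for the conjugation by [V] and the factor of
   [fix_isolated]; adding 1 makes K positive. *)
pose K : R := (n%:R ^+ 2 + 1) ^+ n * (n%:R ^+ 2 * c1) + 1.
have K0 : 0 < K by rewrite ltr_wpDl // !mulr_ge0 ?exprn_ge0 ?addr_ge0 ?exprn_ge0.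
(* K sqrt r is the distance to [A] before [fix_connected], which adds c2 K sqrt r; r <= (e2 / K)^2
   makes it applicable. *)
exists (c2 * K + K), (Num.min e1 ((e2 / K) ^+ 2)); split.
- by rewrite addr_ge0 ?mulr_ge0 // ltW.
- by rewrite lt_min e10 exprn_gt0 // divr_gt0.
move=> lambdat r /andP[r0 re] hr hmaj.
pose mu (p : 'I_n) := (sort_up lambdat)`_p.
have hmu p : `|a p - mu p| <= r.
  rewrite aE ler_norml; apply/andP; split.
    by have := sort_up_lip hr (ltn_ord p); rewrite /mu; lra.
  have hr' i : `|lambdat 0 i - lambda 0 i| <= r by rewrite distrC.
  by have := sort_up_lip hr' (ltn_ord p); rewrite /mu; lra.
have [tot pre] := prefix_excess_ge0 hV hdiag hmaj.
have [|N [uN clN bsN]] := h1 mu r _ hmu tot pre.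
  by rewrite r0 (le_trans re) // ge_min lexx.
pose M := V^t* *m N *m V.
have uM : usim N M by exists (V^t*); rewrite ?trmxCK.
have uM' : usim (diagR mu) M := usim_trans uN uM.
have hM : M \is hermsymmx := usim_herm uM' (diagR_herm mu).
have bsM l : blocksum (component A) M l = blocksum (component A) A l.
  by rewrite (blocksum_conj hV) bsN -(blocksum_conj hV) -eA.
have s0 : 0 <= Num.sqrt r by rewrite sqrtr_ge0.
have clM : close M A (n%:R ^+ 2 * (c1 * Num.sqrt r)).
  have hU : V^t* *m V^t*^t* = 1%:M by rewrite trmxCK.
  by have := close_conj hU clN; rewrite trmxCK -eA.
have [|M2 [u2 cl2 bs2 iso2]] := fix_isolated hA _ hM bsM clM.
  by rewrite !mulr_ge0 ?exprn_ge0.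
have cl2' : close M2 A (K * Num.sqrt r).
  apply: closeW cl2; rewrite /K mulrDl mul1r !mulrA lerDl //.
have hsK : 0 <= K * Num.sqrt r <= e2.
  rewrite mulr_ge0 ?(ltW K0) //= mulrC -ler_pdivlMr //.
  have -> : e2 / K = Num.sqrt ((e2 / K) ^+ 2).
    by rewrite sqrtr_sqr ger0_norm // divr_ge0 // ltW.
  by rewrite ler_wsqrtr // (le_trans re) // ge_min lexx orbT.
have [M3 [u3 cl3 dg3]] := h2 M2 (usim_herm u2 hM) bs2 iso2 _ hsK cl2'.
have u3' := usim_trans uM' (usim_trans u2 u3).
have hM3 := usim_herm u3' (diagR_herm mu).
exists M3; split => //.
- by rewrite /has_eigenvalues (usim_char_poly u3'); exact: eigenvalues_sort_up.
- by move=> i; rewrite dgE // dg3 -dgE // hdiag.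
apply: closeC; rewrite mulrDl -mulrA; exact: close_trans cl3 cl2'.
Qed.

Lemma frobenius_norm_close (M N : 'M[C]_n) (r : R) : 0 <= r -> close M N r ->
  frobenius_norm (M - N) <= n%:R * r.
Proof.
move=> r0 h; rewrite /frobenius_norm -[leRHS]ger0_norm ?mulr_ge0 // -sqrtr_sqr.
apply: ler_wsqrtr; apply: le_trans (_ : \sum_(i < n) \sum_(j < n) r ^+ 2 <= _).
  apply: ler_sum => i _; apply: ler_sum => j _.
  have hij : ComplexField.Normc.normc ((M - N) i j) <= r.
    by rewrite -lecR !mxE; exact: h.
  have h0 : 0 <= ComplexField.Normc.normc ((M - N) i j).
    by rewrite -lecR; exact: (normr_ge0 ((M - N) i j)).
  by rewrite ler_pXn2r // nnegrE.
rewrite !sumr_const !card_ord -[leLHS]mulr_natl -[r ^+ 2 *+ n]mulr_natl.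
by rewrite mulrA -expr2 -exprMn.
Qed.

Lemma le_l2norm (x : 'rV[R]_n) i : `|x 0 i| <= l2norm x.
Proof.
rewrite /l2norm -sqrtr_sqr; apply: ler_wsqrtr.
by rewrite (bigD1 i) //= lerDl; apply: sumr_ge0 => j _; exact: sqr_ge0.
Qed.

End Uniform.

Theorem theorem1p5 (R : realType) (n : nat) (A : 'M[R[i]]_n)
    (hA : A \is hermsymmx) : schur_horn_continuous A.
Proof.
move=> lambda d hev hdiag lambdat hO hmaj.
have [c [e0 [c0 e00 h]]] := schur_horn_uniform hA hev hdiag.
have [K K0 hK] : exists2 K : R, 0 < K & \forall e \near (0^'+)%classic,
    l2norm (lambda - lambdat e) <= K * e.
  have /eqO_exP [K K0 hK] := hO; exists K => //.
  near=> e.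
  have e_gt0 : 0 < e by near: e; exact: nbhs_right_gt.
  rewrite -[X in K * X]gtr0_norm //; apply: le_trans (ler_norm _) _.
  by near: e.
pose good e M := [/\ M \is hermsymmx, has_eigenvalues M (lambdat e),
  has_diagonal M d & close A M (c * Num.sqrt (K * e))].
(* A choice for each [e]; the value 0 occurs only where no good matrix exists, hence not for small
   positive [e]. *)
pose Bt e := if pselect (exists M, good e M) is left ex then projT1 (cid ex) else 0.
have hBt : \forall e \near (0^'+)%classic, good e (Bt e).
  near=> e; rewrite /Bt; case: pselect => [ex|[]]; first exact: projT2 (cid ex).
  have e_gt0 : 0 < e by near: e; exact: nbhs_right_gt.
  apply: (h (lambdat e) (K * e)).
  - rewrite mulr_ge0 ?(ltW e_gt0) ?(ltW K0) //= mulrC -ler_pdivlMr //.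
    by near: e; apply: nbhs_right_le; rewrite divr_gt0.
  - move=> i; have := le_l2norm (lambda - lambdat e) i; rewrite !mxE => hi.
    by apply: (le_trans hi); near: e.
  - by near: e.
exists Bt; split; first by apply: filterS hBt => e [].
(* The factor n passes from entries to the Frobenius norm; the 1 ensures a positive constant. *)
apply/eqO_exP; exists (n%:R * (c * Num.sqrt K) + 1).
  by rewrite ltr_wpDl // !mulr_ge0 ?sqrtr_ge0.
near=> e.
have e_gt0 : 0 < e by near: e; exact: nbhs_right_gt.
have [_ _ _ hcl] : good e (Bt e) by near: e.
rewrite powR12_sqrt ?(ltW e_gt0) //.
rewrite !ger0_norm ?sqrtr_ge0 //.
apply: le_trans (frobenius_norm_close _ hcl) _.
  by rewrite mulr_ge0 ?sqrtr_ge0.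
rewrite sqrtrM ?(ltW K0) // mulrDl mul1r !mulrA lerDl sqrtr_ge0 //.
Unshelve. all: by end_near.
Qed.
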